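(* Let $(K,v)$ be a perfect valued field of rank one with $\operatorname{char}K=p$ an odd prime, and let $(F|K,w)$ be an immediate extension of valued function fields of transcendence degree one. Assume that $K=K^r$. Let $X\in F\setminus K$ be transcendental over $K$ and set $I:=IC(K(X)|K,w)$. Let $\mathcal C\subset(I,v)$ be a pseudo-convergent sequence corresponding to the immediate extension $(I(X)|I,w)$. Then $\mathcal C$ is of transcendental type.
   Context: $(F|K,w)$ is a finitely generated field extension of transcendence degree one with a valuation $w$ on $F$ extending $v$; immediate means $wF=vK$ and $Fw=Kv$. Fix an extension of $w$ to an algebraic closure $\overline F$, again denoted $w$; its restriction to $\overline K\subset\overline F$ (and subfields) is denoted $v$. Henselizations $E^h$ are taken inside $\overline F$ with respect to this extension. Implicit constant field: $IC(K(X)|K,w):=\overline K\cap K(X)^h$. Absolute ramification field: $G^r:=\{\sigma\in\mathrm{Gal}(\overline K|K)\mid v(\sigma a-a)>va\ \text{for all } a\in\overline K\setminus\{0\}\}$ and $K^r$ is the fixed field of $G^r$ in $\overline K$. Pseudo-convergent sequences: $\{z_\nu\}_{\nu<\lambda}\subset I$ ($\lambda$ a limit ordinal) is pseudo-convergent if $v(z_\nu-z_\mu)<v(z_\mu-z_\rho)$ for all $\nu<\mu<\rho<\lambda$; $Y$ is a limit if $w(Y-z_\nu)=v(z_\nu-z_{\nu+1})$ for all $\nu$. It corresponds to $(I(X)|I,w)$ if it has no limit in $I$ and has $X$ as a limit. It is of transcendental type if for every $f\in I[X]$ the sequence $\{vf(z_\nu)\}_{\nu<\lambda}$ is ultimately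 constant. *)

(* Defs.v *)
(* All fields are subfields, given as classical sets, of one algebraically
   closed field L, which plays the role of the fixed algebraic closure of F;
   v denotes the restriction of the valuation w of L to any of these
   subfields. *)
From HB Require Import structures.
From mathcomp Require Import all_boot all_order all_algebra.
From mathcomp Require Import boolp classical_sets functions.

Set Implicit Arguments.
Unset Strict Implicit.
Unset Printing Implicit Defensive.

Import Order.TTheory GRing.Theory.

Local Open Scope classical_set_scope.
Local Open Scope ring_scope.

(* Totally ordered abelian groups; totality is a field of the mixin because
   inheriting from Order.Total would clash with the existing hierarchy of
   numeric structures. *)
HB.mixin Record isOrderedGroup G of Num.POrderedZmodule G := {
  leo_total : total (<=%O : rel G);
  leo_add2l : forall z x y : G, x <= y -> z + x <= z + y
}.

#[short(type="orderedGroupType")]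
HB.structure Definition OrderedGroup :=
  { G of Num.POrderedZmodule G & isOrderedGroup G }.

(* [value G] is G together with an element None, larger than every element
   of G, which is the value of 0. *)
Definition value (G : orderedGroupType) : Type := option G.

Section ValueOrder.
Variable G : orderedGroupType.
Implicit Types x y z : value G.

HB.instance Definition _ := Choice.on (value G).

Definition le_value x y : bool :=
  match x, y with
  | _, None => true
  | None, Some _ => false
  | Some a, Some b => a <= b
  end.

Definition add_value x y : value G :=
  match x, y with
  | Some a, Some b => Some (a + b)
  | _, _ => None
  end.

Fact le_value_refl : reflexive le_value.
Proof. by case=> /=. Qed.

Fact le_value_anti : antisymmetric le_value.
Proof. by case=> [a|] [b|] //= /le_anti ->. Qed.

Fact le_value_trans : transitive le_value.
Proof. by case=> [b|] [a|] [c|] //=; apply: le_trans. Qed.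

HB.instance Definition _ := Order.Le_isPOrder.Build ring_display (value G)
  le_value_refl le_value_anti le_value_trans.

Fact le_value_total : total le_value.
Proof. by case=> [a|] [b|] //=; apply: leo_total. Qed.

HB.instance Definition _ :=
  Order.POrder_isTotal.Build ring_display (value G) le_value_total.

End ValueOrder.

Section Subfields.
Variable L : fieldType.
Implicit Types (A B S : set L) (a x y : L).

Definition subfield A : Prop := GRing.divring_closed [in A].

Definition adjoin A S : set L := smallest subfield (A `|` S).

Definition algebraic_over A x : Prop :=
  exists p : {poly L}, [/\ p != 0, p \is a polyOver [in A] & root p x].

Definition transcendental_over A x : Prop := ~ algebraic_over A x.

Definition algebraic_closure A : set L := [set x | algebraic_over A x].

(* Finitely generated of transcendence degree one, with transcendence
   basis {t}. *)
Definition function_field_trdeg1 A B : Prop :=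
  [/\ A `<=` B,
      exists s : seq L, B = adjoin A [set` s]
    & exists t, [/\ B t, transcendental_over A t
                  & B `<=` algebraic_closure (adjoin A [set t])]].

(* For fields of characteristic p. *)
Definition perfect (p : nat) A : Prop := A `<=` [set y ^+ p | y in A].

(* Elements of Gal(B | A); the values of s outside B are irrelevant. *)
Definition galois_aut A B (s : L -> L) : Prop :=
  [/\ set_bij B B s,
      forall x y, B x -> B y -> s (x + y) = s x + s y,
      forall x y, B x -> B y -> s (x * y) = s x * s y
    & forall x, A x -> s x = x].

End Subfields.

Section ValuedFields.
Variables (L : fieldType) (G : orderedGroupType).
Implicit Types (w : L -> value G) (A B : set L).

Record valuation w : Prop := Valuation {
  valuation_eq_None : forall x, w x = None <-> x = 0;
  valuationM : forall x y, w (x * y) = add_value (w x) (w y);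
  valuationD : forall x y, Order.min (w x) (w y) <= w (x + y)
}.

Definition value_group w A : set G :=
  [set g | exists2 x, A x & w x = Some g].

Definition valuation_ring w A : set L :=
  [set x | A x /\ (Some 0 : value G) <= w x].

(* The residue x + {y | w y > 0} of an element x of the valuation ring of L. *)
Definition residue w (x : L) : set L :=
  [set y | (Some 0 : value G) < w (y - x)].

(* As a subset of the residue field of L. *)
Definition residue_field w A : set (set L) :=
  [set residue w x | x in valuation_ring w A].

Definition immediate w A B : Prop :=
  [/\ A `<=` B, value_group w B = value_group w A
    & residue_field w B = residue_field w A].

Definition convex_subgroup (V H : set G) : Prop :=
  [/\ H `<=` V, GRing.zmod_closed [in H]
    & forall x y : G, V x -> H y -> 0 <= x -> x <= y -> H x].

(* The zero group is the only proper convex subgroup of the value group. *)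
Definition rank_one w A : Prop :=
  value_group w A <> [set 0] /\
  forall H, convex_subgroup (value_group w A) H ->
    H = [set 0] \/ H = value_group w A.

(* Hensel's Lemma holds in (A, v). *)
Definition henselian w A : Prop :=
  forall (f : {poly L}) (b : L),
    f \is a polyOver [in valuation_ring w A] -> valuation_ring w A b ->
    (Some 0 : value G) < w f.[b] -> w f^`().[b] = Some 0 ->
    exists a, [/\ valuation_ring w A a, root f a
                & (Some 0 : value G) < w (a - b)].

(* By the universal property of henselizations, the henselization of A inside
   the algebraically closed valued field (L, w) is the least henselian subfield
   of (L, w) that contains A. *)
Definition henselization w A : set L :=
  smallest [set B | subfield B /\ henselian w B] A.

Definition implicit_constant_field w A (X : L) : set L :=
  algebraic_closure A `&` henselization w (adjoin A [set X]).

Definition ramification_group w A : set (L -> L) :=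
  [set s | galois_aut A (algebraic_closure A) s /\
    forall a, algebraic_closure A a -> a <> 0 -> w a < w (s a - a)].

Definition ramification_field w A : set L :=
  [set a | algebraic_closure A a /\
    forall s, ramification_group w A s -> s a = a].

End ValuedFields.

(* A limit ordinal is represented by a nonempty well-ordered type without
   largest element. *)
Definition limit_ordinal (d : Order.disp_t) (T : orderType d) : Prop :=
  [/\ inhabited T, well_founded (fun i j : T => (i < j)%O)
    & forall i : T, exists j : T, (i < j)%O].

Definition is_succ (d : Order.disp_t) (T : orderType d) (i j : T) : Prop :=
  (i < j)%O /\ forall k : T, (i < k)%O -> (j <= k)%O.

Section PseudoConvergence.
Variables (L : fieldType) (G : orderedGroupType) (w : L -> value G).
Variables (d : Order.disp_t) (T : orderType d).
Implicit Types (z : T -> L) (I : set L).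

Definition pseudo_convergent z : Prop :=
  forall i j k : T, (i < j)%O -> (j < k)%O -> w (z i - z j) < w (z j - z k).

Definition pseudo_limit z (Y : L) : Prop :=
  forall i j : T, is_succ i j -> w (Y - z i) = w (z i - z j).

(* z corresponds to (I(X) | I, w). *)
Definition corresponds z I (X : L) : Prop :=
  (forall Y, I Y -> ~ pseudo_limit z Y) /\ pseudo_limit z X.

Definition transcendental_type z I : Prop :=
  forall f : {poly L}, f \is a polyOver [in I] ->
    exists i0 : T, forall i : T, (i0 <= i)%O -> w f.[z i] = w f.[z i0].

End PseudoConvergence.

(* Main.v *)
(* Suppose that C is not of transcendental type. Some polynomial over I of minimal
   degree then has a root a that is a limit of C; it is algebraic over I and not
   in I. As K = K^r, every conjugate a' <> 0 of a over K satisfies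
   v(a' - a) > v(a), so by a trace argument no proper algebraic extension between I
   and the algebraic closure of K has degree prime to p, and
   I(a) contains some t = h(a) outside I, deg h < deg a, with t^p - t in I.
   By minimality of deg a, no root of a polynomial of smaller degree is a limit
   of C, so v(h(X) - c) = v(t - c) for all c in I. Since I is perfect, iterated
   p-th roots of t^p - t give c in I with (t - c)^(p^k) = t; as the rank is one,
   u = h(X) - t satisfies v(u) >= 0. The residue field of K is algebraically
   closed, hence equal to that of the algebraic closure L of F, so u may be shifted
   by an element of K to have v(u) > 0. Then u^p - u is in K(X)^h, where Hensel's
   Lemma gives u itself; so t is in K(X)^h, hence in I, a contradiction. *)
Require Import Defs.
From HB Require Import structures.
From mathcomp Require Import all_boot all_order all_algebra.
From mathcomp Require Import boolp classical_sets functions.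
From mathcomp Require Import zify ring.

Set Implicit Arguments.
Unset Strict Implicit.
Unset Printing Implicit Defensive.

Import Order.TTheory GRing.Theory.

Local Open Scope classical_set_scope.
Local Open Scope ring_scope.

(** * Subfields and minimal polynomials *)

(** Turns a classical set into a bundled predicate, so that the [rpred] lemmas apply to
    subfields. *)
Definition subfield_of (L : fieldType) (A : set L) (sA : subfield A) :
    divringClosed L :=
  HB.pack_for (divringClosed L) ([in A] : L -> bool)
    (GRing.isDivringClosed.Build L ([in A] : L -> bool) sA).

Lemma subfield_ofP (L : fieldType) (A : set L) (sA : subfield A) x :
  reflect (A x) (x \in subfield_of sA).
Proof. by apply: (iffP idP); rewrite -[x \in _]/(x \in A) in_setE. Qed.

Section SubfieldType.
Variables (L : fieldType) (E : divringClosed L).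

(** The elements of [E] as a field in its own right: polynomial division and matrices over [E] live
    there and are carried to [L] along [\val]. *)
Record subfield_type := SubfieldElt { subfield_val : L; _ : subfield_val \in E }.

HB.instance Definition _ := [isSub for subfield_val].
HB.instance Definition _ := [Choice of subfield_type by <:].
HB.instance Definition _ := [SubChoice_isSubComUnitRing of subfield_type by <:].
HB.instance Definition _ := [SubComUnitRing_isSubIntegralDomain of subfield_type by <:].
HB.instance Definition _ := [SubIntegralDomain_isSubField of subfield_type by <:].

Let vE : {rmorphism subfield_type -> L} := \val.
Implicit Types f g h : {poly L}.

Lemma polyOver_lift f :
  f \is a polyOver E -> exists f' : {poly subfield_type}, f = map_poly \val f'.
Proof.
move=> /polyOverP fE; exists (\poly_(i < size f) insubd (0 : subfield_type) f`_i).
apply/polyP=> i; rewrite (coef_map vE) coef_poly.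
case: ltnP => [_|le]; first by apply/esym/insubdK/fE.
by rewrite nth_default.
Qed.

Lemma polyOver_map (f : {poly subfield_type}) : map_poly \val f \is a polyOver E.
Proof. by apply/polyOverP => i; rewrite (coef_map vE); apply: valP. Qed.

Lemma polyOver_modp f g :
  f \is a polyOver E -> g \is a polyOver E -> f %% g \is a polyOver E.
Proof.
move=> /polyOver_lift[f' ->] /polyOver_lift[g' ->].
by rewrite -(map_modp vE) polyOver_map.
Qed.

Lemma polyOver_divp f g :
  f \is a polyOver E -> g \is a polyOver E -> f %/ g \is a polyOver E.
Proof.
move=> /polyOver_lift[f' ->] /polyOver_lift[g' ->].
by rewrite -(map_divp vE) polyOver_map.
Qed.

Definition algebraic (x : L) : Prop :=
  exists p : {poly L}, [/\ p != 0, p \is a polyOver E & root p x].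

Lemma algebraicP x : algebraic x <-> algebraicOver vE x.
Proof.
split=> [[p [p0 /polyOver_lift[p' def_p] px]]|[p p0 px]].
  by exists p'; rewrite -?def_p //; rewrite def_p (map_poly_eq0 vE) in p0.
by exists (map_poly vE p); rewrite (map_poly_eq0 vE) polyOver_map.
Qed.

Lemma algebraic_mem x : x \in E -> algebraic x.
Proof.
move=> Ex; apply/algebraicP.
by have := algebraic_id vE (SubfieldElt Ex).
Qed.

Definition alg_closure : {pred L} := fun x => `[< algebraic x >].

Lemma alg_closureP x : reflect (algebraic x) (x \in alg_closure).
Proof. exact: asboolP. Qed.

Fact closure_divring : GRing.divring_closed alg_closure.
Proof.
split=> [|x y|x y]; first by apply/alg_closureP/algebraic_mem/rpred1.
- move=> /alg_closureP/algebraicP ax /alg_closureP/algebraicP ay.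
  exact/alg_closureP/algebraicP/algebraic_sub.
- move=> /alg_closureP/algebraicP ax /alg_closureP/algebraicP ay.
  exact/alg_closureP/algebraicP/algebraic_div.
Qed.
HB.instance Definition _ := GRing.isDivringClosed.Build L alg_closure closure_divring.

Lemma mem_closure x : x \in E -> x \in alg_closure.
Proof. by move=> /algebraic_mem/alg_closureP. Qed.

Definition minimal_poly (x : L) (m : {poly L}) : Prop :=
  [/\ m \is monic, m \is a polyOver E, root m x
    & forall h, h \is a polyOver E -> root h x -> m %| h].

Lemma minimal_poly_exists x : algebraic x -> exists m, minimal_poly x m.
Proof.
move=> [p [p0 pE px]].
pose Q n := `[< exists q, [/\ q != 0, q \is a polyOver E, root q x & size q = n] >].
have exQ : exists n, Q n by exists (size p); apply/asboolP; exists p.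
case: (ex_minnP exQ) => n /asboolP[q [q0 qE qx szq]] n_min.
have lq0 : lead_coef q != 0 by rewrite lead_coef_eq0.
exists ((lead_coef q)^-1 *: q); split.
- by rewrite monicE lead_coefZ mulVf.
- rewrite polyOverZ ?rpredV // lead_coefE; exact: (polyOverP qE).
- by rewrite rootZ ?invr_eq0.
move=> h hE hx; rewrite dvdpZl ?invr_eq0 // /dvdp.
apply: contraT => r0.
suff : (n <= size (h %% q)%R)%N by rewrite leqNgt -szq ltn_modp q0.
apply: n_min; apply/asboolP; exists (h %% q); split=> //.
  exact: polyOver_modp.
have := hx; rewrite [h in root h](divp_eq h q) rootE hornerD hornerM.
by rewrite (rootP qx) mulr0 add0r.
Qed.

(** Transitivity of algebraicity: once [f] is made monic, its coefficients are integral over [E],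
    hence so is its root. *)
Lemma closure_root x f : f != 0 -> root f x -> f \is a polyOver alg_closure ->
  x \in alg_closure.
Proof.
move=> f0 fx /polyOverP fC; apply/alg_closureP/algebraicP/integral_algebraic.
have lf0 : lead_coef f != 0 by rewrite lead_coef_eq0.
apply: (@integral_root_monic _ _ vE _ ((lead_coef f)^-1 *: f)).
- by rewrite monicE lead_coefZ mulVf.
- by rewrite rootZ ?invr_eq0.
move=> _ /(nthP 0)[i _ <-]; apply/integral_algebraic/algebraicP/alg_closureP.
by rewrite coefZ rpredM ?rpredV // lead_coefE.
Qed.

Lemma closure_horner x h : h \is a polyOver E -> x \in alg_closure ->
  h.[x] \in alg_closure.
Proof.
move=> hE xE; apply: rpred_horner => //.
by apply/polyOverP => i; apply/mem_closure/(polyOverP hE).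
Qed.

Lemma minimal_poly_size_gt1 x m : minimal_poly x m -> (1 < size m)%N.
Proof. by case=> m1 _ mx _; apply: root_size_gt1 mx; apply: monic_neq0. Qed.

Lemma minimal_poly_irreducible x m f g : minimal_poly x m ->
  f \is a polyOver E -> g \is a polyOver E -> m = f * g ->
  size f = 1%N \/ size g = 1%N.
Proof.
move=> [m1 mE mx minm] fE gE def_m.
have m0 := monic_neq0 m1.
have f0 : f != 0 by apply: contraNneq m0 => f0; rewrite def_m f0 mul0r.
have g0 : g != 0 by apply: contraNneq m0 => g0; rewrite def_m g0 mulr0.
have sz : size m = (size f + size g).-1 by rewrite def_m size_mul.
move: f0 g0; rewrite -!size_poly_gt0; case def_sf: (size f) => [|sf] // _.
case def_sg: (size g) => [|sg] // _.
have /orP[fx|gx] : root f x || root g x by rewrite -rootM -def_m.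
  have := dvdp_leq _ (minm f fE fx); rewrite -size_poly_gt0 sz def_sf def_sg.
  by move=> /(_ isT) ?; right; lia.
have := dvdp_leq _ (minm g gE gx); rewrite -size_poly_gt0 sz def_sf def_sg.
by move=> /(_ isT) ?; left; lia.
Qed.

(** Only inversion needs an argument: if [q * 'X + c] is the minimal polynomial of y <> 0, then c <>
    0 and 1/y = -q(y)/c. *)
Fact simple_ext_divring x : x \in alg_closure ->
  GRing.divring_closed (fun y : L => `[< exists2 h, h \is a polyOver E & y = h.[x] >]).
Proof.
move=> Cx; split=> [|_ _ /asboolP[f fE ->] /asboolP[g gE ->]|].
- by apply/asboolP; exists 1; rewrite ?rpred1 ?hornerC.
- by apply/asboolP; exists (f - g); rewrite ?rpredB // hornerD hornerN.
move=> _ _ /asboolP[f fE ->] /asboolP[g gE ->]; apply/asboolP.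
have [->|y0] := eqVneq g.[x] 0; first by exists 0; rewrite ?rpred0 // invr0 mulr0 horner0.
have [m m_min] := minimal_poly_exists (alg_closureP _ (closure_horner gE Cx)).
have [m1 mE my minm] := m_min.
pose q := m %/ 'X; pose c := m.[0].
have qE : q \is a polyOver E by rewrite polyOver_divp ?polyOverX.
have cE : c \in E by rewrite rpred_horner ?rpred0.
have def_m : m = q * 'X + c%:P.
  by rewrite {1}(divp_eq m 'X) /q /c; congr (_ + _); rewrite -['X]subr0 modp_XsubC.
(* If c = 0, then [q] would vanish at y although its degree is smaller than that of [m]. *)
have c0 : c != 0.
  apply/eqP => c0; have q_y : root q g.[x].
    have := rootP my; rewrite def_m c0 addr0 hornerM hornerX => /eqP.
    by rewrite mulf_eq0 (negPf y0) orbF.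
  have q0 : q != 0.
    by apply: contraNneq (monic_neq0 m1) => q0; rewrite def_m c0 addr0 q0 mul0r.
  have := dvdp_leq q0 (minm q qE q_y).
  by rewrite {1}def_m c0 addr0 size_mulX // ltnn.
exists (f * (- c^-1 *: (q \Po g))).
  by rewrite rpredM // polyOverZ ?rpredN ?rpredV // polyOver_comp.
rewrite hornerM hornerZ horner_comp; congr (_ * _); apply: (mulIf y0).
rewrite mulVf // -mulrA; have := rootP my; rewrite {1}def_m hornerD hornerC.
rewrite hornerM hornerX => /eqP; rewrite addr_eq0 => /eqP->.
by rewrite mulrNN mulVf.
Qed.

End SubfieldType.

(** The field E(x): for algebraic [x], the polynomial expressions in [x] already form a field. *)
Definition simple_ext (L : fieldType) (E : divringClosed L) (x : L)
    (Cx : x \in alg_closure E) : divringClosed L :=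
  HB.pack_for (divringClosed L)
    ((fun y => `[< exists2 h, h \is a polyOver E & y = h.[x] >]) : L -> bool)
    (GRing.isDivringClosed.Build L _ (simple_ext_divring Cx)).

Lemma simple_extP (L : fieldType) (E : divringClosed L) x (Cx : x \in alg_closure E) y :
  reflect (exists2 h, h \is a polyOver E & y = h.[x]) (y \in simple_ext Cx).
Proof. exact: asboolP. Qed.

(** * Valuations *)

Section ValuationTheory.
Variables (L : fieldType) (G : orderedGroupType) (w : L -> value G).
Hypothesis vw : valuation w.
Implicit Types (x y z a b c : L).

Lemma val0 : w 0 = None.
Proof. exact/(valuation_eq_None vw). Qed.

Lemma val_Some x : x != 0 -> exists g, w x = Some g.
Proof.
move=> x0; case wx: (w x) => [g|]; first by exists g.
by move/(valuation_eq_None vw)/eqP: wx; rewrite (negPf x0).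
Qed.

Lemma valM_le c x y : w x <= w y -> w (c * x) <= w (c * y).
Proof.
rewrite !(valuationM vw).
case: (w c) (w x) (w y) => [k|] [g|] [h|] //; exact: leo_add2l.
Qed.

Lemma valM_lt c x y : c != 0 -> w x < w y -> w (c * x) < w (c * y).
Proof.
move=> /val_Some[k wc]; rewrite !lt_neqAle => /andP[nxy /(valM_le c) le_c].
rewrite le_c andbT; apply: contra nxy; rewrite !(valuationM vw) wc.
case: (w x) (w y) => [g|] [h|] //= /eqP[]; first by move/addrI->.
Qed.

Lemma valM_leE c x y : c != 0 -> (w (c * x) <= w (c * y)) = (w x <= w y).
Proof.
move=> c0; apply/idP/idP; last exact: valM_le.
by apply: contraTT; rewrite -!ltNge; apply: valM_lt.
Qed.

Lemma valM_ltE c x y : c != 0 -> (w (c * x) < w (c * y)) = (w x < w y).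
Proof. by move=> c0; rewrite !ltNge valM_leE. Qed.

(** Most statements below write the value 0 as [w 1], so that they compare values of elements of
    [L]. *)
Lemma val1 : w 1 = Some 0.
Proof.
have [g w1] := val_Some (oner_neq0 L); have := valuationM vw 1 1.
by rewrite mulr1 w1 => -[]; rewrite -{1}[g]addr0 => /addrI <-.
Qed.

(** The value g of -1 satisfies g + g = 0, and an ordered group has no torsion. *)
Lemma valN1 : w (-1) = w 1.
Proof.
have := valuationM vw (-1) (-1); rewrite mulrNN mulr1.
have /val_Some[g wN] : -1 != 0 :> L by rewrite oppr_eq0 oner_neq0.
rewrite wN val1 => -[/esym gg0]; congr Some; apply/le_anti.
by case/orP: (leo_total g 0) => le_g; have := leo_add2l g _ _ le_g;
  rewrite gg0 addr0 le_g => ->.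
Qed.

Lemma valN x : w (- x) = w x.
Proof. by rewrite -mulN1r -[in RHS](mul1r x) !(valuationM vw) valN1. Qed.

Lemma valB x y : w (x - y) = w (y - x).
Proof. by rewrite -valN opprB. Qed.

Lemma valM_eq a b x y : w a = w b -> w x = w y -> w (a * x) = w (b * y).
Proof. by rewrite !(valuationM vw) => -> ->. Qed.

Lemma valX_eq n x y : w x = w y -> w (x ^+ n) = w (y ^+ n).
Proof. by move=> wxy; elim: n => // n IH; rewrite !exprS; apply: valM_eq. Qed.

Lemma valX_le n x y : w x <= w y -> w (x ^+ n) <= w (y ^+ n).
Proof.
move=> wxy; elim: n => // n IH; rewrite !exprS.
by apply: le_trans (valM_le x IH) _; rewrite ![_ * y ^+ n]mulrC; apply: valM_le.
Qed.

Lemma val_lt_neq0 x y : w x < w y -> x != 0.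
Proof. by apply: contraTneq => ->; rewrite val0 -leNgt; case: (w y). Qed.

Lemma valX_lt n x y : (0 < n)%N -> w x < w y -> w (x ^+ n) < w (y ^+ n).
Proof.
elim: n => // -[|n] IH // _ lt_xy; rewrite exprS [y ^+ _]exprS.
apply: lt_le_trans (valM_lt (val_lt_neq0 lt_xy) (IH isT lt_xy)) _.
by rewrite ![_ * y ^+ _]mulrC; apply/valM_le/ltW.
Qed.

Lemma valD_ge c x y : w c <= w x -> w c <= w y -> w c <= w (x + y).
Proof.
by move=> cx cy; apply: le_trans (valuationD vw x y); rewrite le_min cx.
Qed.

Lemma valD_gt c x y : w c < w x -> w c < w y -> w c < w (x + y).
Proof.
by move=> cx cy; apply: lt_le_trans (valuationD vw x y); rewrite lt_min cx.
Qed.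

Lemma valB_ge c x y : w c <= w x -> w c <= w y -> w c <= w (x - y).
Proof. by move=> cx cy; apply: valD_ge; rewrite ?valN. Qed.

Lemma valB_gt c x y : w c < w x -> w c < w y -> w c < w (x - y).
Proof. by move=> cx cy; apply: valD_gt; rewrite ?valN. Qed.

Lemma valD_eq x y : w x < w y -> w (x + y) = w x.
Proof.
move=> xy; apply: le_anti; rewrite valD_ge ?lexx ?(ltW xy) // andbT leNgt.
apply/negP => xxy; suff : w x < w x by rewrite ltxx.
by rewrite -{2}(addrK y x); apply: valB_gt.
Qed.

Lemma val_sum_gt (I : Type) (r : seq I) (P : pred I) c (F : I -> L) : c != 0 ->
  (forall i, P i -> w c < w (F i)) -> w c < w (\sum_(i <- r | P i) F i).
Proof.
move=> c0 cF; apply: (big_ind (fun s => w c < w s)) => //; last exact: valD_gt.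
by have [g ->] := val_Some c0; rewrite val0.
Qed.

Lemma val_nat_ge n : w 1 <= w n%:R.
Proof. by elim: n => [|n IH]; rewrite ?mulrSr ?valD_ge // val0 val1. Qed.

(* The inverse of [n] in [L] is also the image of a natural number. *)
Lemma val_natr p n : p \in [pchar L] -> ~~ (p %| n)%N -> w n%:R = w 1.
Proof.
move=> pL pn; have p_pr := pcharf_prime pL.
apply: le_anti; rewrite val_nat_ge andbT.
have [u] : exists u, (u * n = 1 %[mod p])%N.
  have cop : coprime n p by rewrite coprime_sym prime_coprime.
  have n0 : (0 < n)%N by rewrite lt0n; apply: contraNneq pn => ->; rewrite dvdn0.
  case: (egcdnP p n0) => u v; rewrite (eqP cop) => def_un _.
  by exists u; rewrite def_un modnMDl.
move=> /(congr1 (fun k => k%:R : L)); rewrite !(GRing.natr_mod_pchar pL) natrM => un1.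
have := valM_le n%:R (val_nat_ge u); rewrite mulr1.
by rewrite mulrC un1.
Qed.

End ValuationTheory.

(** * Conjugates over a field equal to its absolute ramification field *)

Section RamificationField.
Variables (L : closedFieldType) (G : orderedGroupType) (w : L -> value G).
Variables (A : set L) (sA : subfield A).
Hypotheses (vw : valuation w) (A_ram : A = ramification_field w A).
Let K : divringClosed L := subfield_of sA.
Implicit Types (a b c x y : L) (s t : L -> L) (r : seq L).

Let closureE x : (x \in alg_closure K) <-> algebraic_closure A x.
Proof. by split=> [/alg_closureP|ax]; last exact/alg_closureP. Qed.

(** Membership in the closure is proved along with the formula because [s] is additive and
    multiplicative only there. *)
Lemma prodXsubC_aut s r : galois_aut A (algebraic_closure A) s ->
    {subset r <= alg_closure K} ->
  forall i, (\prod_(c <- r) ('X - c%:P))`_i \in alg_closure K /\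
    s (\prod_(c <- r) ('X - c%:P))`_i = (\prod_(c <- r) ('X - (s c)%:P))`_i.
Proof.
move=> [_ sD sM sid]; elim: r => [|a r IH] rK i.
  rewrite !big_nil coef1; split; first exact: rpred_nat.
  by apply/sid/(subfield_ofP sA)/rpred_nat.
have [|c_cl c_s] := all_and2 (IH _).
  by move=> c rc; apply: rK; rewrite inE rc orbT.
have aK : a \in alg_closure K by apply: rK; rewrite mem_head.
have s0 : s 0 = 0 by apply/sid/(subfield_ofP sA)/rpred0.
have sM' x y : x \in alg_closure K -> y \in alg_closure K -> s (x * y) = s x * s y.
  by move=> /closureE xK /closureE; apply: sM.
have sB x y : x \in alg_closure K -> y \in alg_closure K -> s (x - y) = s x - s y.
  move=> xK yK; apply/eqP; rewrite eq_sym subr_eq -sD ?subrK //; apply/closureE => //.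
  exact: rpredB.
have hdK : (if (i == 0)%N then 0 else (\prod_(c <- r) ('X - c%:P))`_i.-1) \in alg_closure K.
  by case: (i == 0)%N; rewrite ?rpred0.
rewrite !big_cons !mulrBl !coefB !coefXM !coefCM.
split; first by rewrite rpredB ?rpredM.
rewrite sB ?rpredM // sM' // c_s; congr (_ - _).
by case: (i == 0)%N.
Qed.

(** Elements of the group preserve values, so s(ta) - ta and ta - a both have value greater than
    v(a). *)
Lemma ramification_group_comp s t : ramification_group w A s ->
  ramification_group w A t -> ramification_group w A (s \o t).
Proof.
move=> [[bs sD sM sid] sram] [[bt tD tM tid] tram].
have [t_fun _ _] := bt.
split=> [|a aA a0 /=].
  split=> [|x y xA yA|x y xA yA|x xA] /=; first exact: set_bij_comp bt bs.
  - by rewrite tD // sD //; apply: t_fun.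
  - by rewrite tM // sM //; apply: t_fun.
  - by rewrite tid // sid.
have wta : w (t a) = w a.
  by rewrite -[t a](subrK a) addrC; apply: valD_eq => //; apply: tram.
have ta0 : t a <> 0.
  by move=> ta0; move: wta; rewrite ta0 val0 // => /esym/(valuation_eq_None vw).
rewrite -(subrKA (t a)); apply: valD_gt => //; last exact: tram.
by rewrite -wta; apply: sram => //; apply: t_fun.
Qed.

(** [r] is the orbit of [a] under the ramification group, finite because it consists of roots of
    [q]. The group permutes it, so the coefficients of the product are fixed by the group and lie in
    K^r = K. *)
Lemma ramification_orbit a : a \in alg_closure K ->
  exists r : seq L, [/\ uniq r, a \in r, \prod_(c <- r) ('X - c%:P) \is a polyOver K
    & forall c, c \in r -> exists2 s, ramification_group w A s & c = s a].
Proof.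
move=> aK; have /alg_closureP[q [q0 qK qa]] := aK.
have [rts def_q] := closed_field_poly_normal q.
pose r := undup [seq c <- rts | `[< exists2 s, ramification_group w A s & c = s a >]].
have rP c : reflect (exists2 s, ramification_group w A s & c = s a) (c \in r).
  rewrite mem_undup mem_filter; apply: (iffP andP) => [[/asboolP]//|[s s_ram ->]].
  split; first by apply/asboolP; exists s.
  have [[[s_fun _ _] sD sM sid] _] := s_ram.
  have lc0 : lead_coef q != 0 by rewrite lead_coef_eq0.
  rewrite -root_prod_XsubC -(rootZ _ _ lc0) -def_q.
  have {}aK : algebraic_closure A a by apply/closureE.
  suff hs f : f \is a polyOver K -> s f.[a] = f.[s a].
    by rewrite rootE -hs // (rootP qa) sid //; apply/(subfield_ofP sA)/rpred0.
  elim/poly_ind: f => [|f e IH] fK.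
    by rewrite !horner0 sid //; apply/(subfield_ofP sA)/rpred0.
  have eK : e \in K.
    by have := polyOverP fK 0%N; rewrite coefD coefMX coefC eqxx add0r.
  have {}fK : f \is a polyOver K.
    apply/polyOverP => i; have := polyOverP fK i.+1.
    by rewrite coefD coefMX coefC addr0.
  have fa : f.[a] \in alg_closure K by apply: closure_horner => //; apply/closureE.
  have eA : A e by apply/(subfield_ofP sA).
  have fa_a : f.[a] * a \in alg_closure K by rewrite rpredM //; apply/closureE.
  rewrite !hornerMXaddC sD ?sM ?(sid _ eA) ?IH //; apply/closureE => //.
  exact: mem_closure.
have r_cl : {subset r <= alg_closure K}.
  move=> _ /rP[s [[[s_fun _ _] _ _ _] _] ->].
  by apply/closureE/s_fun/closureE.
exists r; split=> [|||c /rP//]; first exact: undup_uniq.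
  apply/rP; exists id => //; split; last first.
    move=> b _ b0; rewrite subrr val0 //; have [g ->//] := val_Some vw (introN eqP b0).
  by split=> //; split=> [|x y _ _|y yA] //; exists y.
apply/polyOverP => i; apply/subfield_ofP; rewrite A_ram.
have PK : (\prod_(c <- r) ('X - c%:P))`_i \in alg_closure K.
  suff /polyOverP : \prod_(c <- r) ('X - c%:P) \is a polyOver (alg_closure K) by [].
  by rewrite big_seq rpred_prod // => c /r_cl cK; rewrite polyOverXsubC.
split; first exact/closureE.
move=> t t_ram; have [t_aut _] := t_ram; have [[_ t_inj _] _ _ _] := t_aut.
rewrite (prodXsubC_aut t_aut r_cl i).2 -(big_map t xpredT (fun c => 'X - c%:P)).
(* [t] maps the finite orbit injectively into itself, hence permutes it. *)
suff /(perm_big _)-> : perm_eq (map t r) r by [].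
have uniq_tr : uniq (map t r).
  rewrite map_inj_in_uniq ?undup_uniq // => x y /r_cl xK /r_cl yK.
  by apply: t_inj; rewrite in_setE; apply/closureE.
have sub_tr : {subset map t r <= r}.
  move=> _ /mapP[x /rP[s s_ram ->] ->]; apply/rP; exists (t \o s) => //.
  exact: ramification_group_comp.
have [|_ eq_tr] := uniq_min_size uniq_tr sub_tr; first by rewrite size_map.
by apply: uniq_perm => //; apply: undup_uniq.
Qed.

End RamificationField.

(* What the hypothesis [K = K^r] provides. *)
Definition ramified_conjugates (L : closedFieldType) (G : orderedGroupType)
    (w : L -> value G) (K : divringClosed L) : Prop :=
  forall a, a \in alg_closure K -> exists r : seq L,
    [/\ uniq r, a \in r, \prod_(c <- r) ('X - c%:P) \is a polyOver K
      & forall c, c \in r -> a != 0 -> w a < w (c - a)].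

(** * Minimal polynomials over fields between [K] and its algebraic closure *)

Section RamifiedConjugates.
Variables (L : closedFieldType) (G : orderedGroupType) (w : L -> value G).
Variables (p : nat) (K : divringClosed L).
Hypotheses (vw : valuation w) (pL : p \in [pchar L]).
Hypothesis K_conj : ramified_conjugates w K.
Implicit Types (E : divringClosed L) (a b c s t x y : L) (f g h m q : {poly L}).

(** Let P be the product over the orbit [r] of h(t). Then P(h(X)) vanishes at [t], so [m] divides it
    and h(s) lies in the orbit as well. *)
Lemma val_conj_gt E t m h s : {subset K <= E} -> minimal_poly E t m ->
  h \is a polyOver E -> h.[t] \in alg_closure K -> h.[t] != 0 -> root m s ->
  w h.[t] < w (h.[s] - h.[t]).
Proof.
move=> KE [_ _ _ m_min] hE /K_conj[r [_ htr PK r_gt]] ht0 ms.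
apply: r_gt => //; rewrite -root_prod_XsubC rootE -horner_comp -rootE.
apply: root_dvdp ms; apply: m_min; last first.
  by rewrite rootE horner_comp -rootE root_prod_XsubC.
by rewrite polyOver_comp //; apply/polyOverP => i; apply/KE/(polyOverP PK).
Qed.

(** [m] divides the product over the orbit of [t], whose roots are distinct. *)
Lemma minimal_poly_separable E t m s : {subset K <= E} -> t \in alg_closure K ->
  minimal_poly E t m -> ~~ (('X - s%:P) ^+ 2 %| m).
Proof.
move=> KE /K_conj[r [ur tr PK _]] [_ _ _ m_min]; apply/negP => ssm.
have PE : \prod_(c <- r) ('X - c%:P) \is a polyOver E.
  by apply/polyOverP => i; apply/KE/(polyOverP PK).
have := m_min _ PE; rewrite root_prod_XsubC tr => /(_ isT)/(dvdp_trans ssm) ssr.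
have sr : s \in r.
  by rewrite -root_prod_XsubC -dvdp_XsubCl; apply: dvdp_trans ssr; rewrite dvdp_exp.
move: ssr; rewrite (perm_big _ (perm_to_rem sr)) big_cons expr2.
rewrite dvdp_mul2l ?polyXsubC_eq0 // dvdp_XsubCl root_prod_XsubC.
by rewrite mem_rem_uniq // inE eqxx.
Qed.

(** Every term has the leading term of [b], so the sum has that of n b, where the number n of terms
    has value 0. *)
Lemma sum_neq0 b (I : eqType) (r : seq I) (F : I -> L) : b != 0 ->
  (forall i, i \in r -> w b < w (F i - b)) -> ~~ (p %| size r)%N ->
  \sum_(i <- r) F i != 0.
Proof.
move=> b0 F_gt pr; apply/eqP => sum0.
have : w b < w (\sum_(i <- r) (F i - b)).
  by rewrite big_seq; apply: val_sum_gt.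
rewrite sumrB sum0 sub0r valN // big_const_seq count_predT iter_addr_0.
by rewrite -mulr_natr (valM_eq vw (erefl _) (val_natr vw pL pr)) mulr1 ltxx.
Qed.

Section Intermediate.
Variable E : divringClosed L.
Hypotheses (KE : {subset K <= E}) (EK : {subset E <= alg_closure K}).

Lemma algebraic_above t : t \in alg_closure K -> algebraic E t.
Proof.
move=> /alg_closureP[q [q0 /polyOverP qK qt]]; exists q; split=> //.
by apply/polyOverP => i; apply: KE.
Qed.

Lemma minimal_poly_deg1 t m : t \in alg_closure K -> minimal_poly E t m ->
  ~~ (p %| (size m).-1)%N -> t \in E.
Proof.
move=> tK m_min; have [m1 mE mt _] := m_min.
have [r def_m] := closed_field_poly_normal m.
have {}def_m : m = \prod_(z <- r) ('X - z%:P).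
  by rewrite {1}def_m (monicP m1) scale1r.
have sz_m : size m = (size r).+1 by rewrite def_m size_prod_XsubC.
rewrite sz_m /= => pr.
have r0 : size r != 0%N by apply: contraNneq pr => ->; rewrite dvdn0.
have n0 : (size r)%:R != 0 :> L by rewrite -(dvdn_pcharf pL).
have sumE : \sum_(z <- r) z \in E.
  rewrite -rpredN -(coefPn_prod_XsubC r0) -def_m; exact: (polyOverP mE).
(* The mean of the conjugates of [t]. If t <> e, the conjugates of t - e have sum 0 but share one
   leading term, against [sum_neq0]. *)
pose e := (\sum_(z <- r) z) / (size r)%:R.
have eE : e \in E by rewrite rpred_div ?rpred_nat.
have [te|te] := eqVneq (t - e) 0; first by rewrite (subr0_eq te).
have : \sum_(z <- r) (z - e) != 0.
  apply: (sum_neq0 te) => // z zr.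
  have := @val_conj_gt E t m ('X - e%:P) z KE m_min.
  rewrite !hornerXsubC; apply=> //.
  - by rewrite polyOverXsubC.
  - by rewrite rpredB // EK.
  - by rewrite def_m root_prod_XsubC.
rewrite sumrB big_const_seq count_predT iter_addr_0 -mulr_natr divfK //.
by rewrite subrr eqxx.
Qed.

(** Split off the minimal polynomial of a root of [q]. If its degree is prime to [p], the root is in
    [E]; otherwise the cofactor still has degree prime to [p], and induction applies. *)
Lemma root_of_degree_prime_to_p q : q != 0 -> q \is a polyOver E ->
    (forall x, root q x -> x \in alg_closure K) -> ~~ (p %| (size q).-1)%N ->
  exists2 x, x \in E & root q x.
Proof.
have [n] := ubnP (size q); elim: n q => // n IH q; rewrite ltnS => le_q q0 qE q_cl pq.
have [t qt] : exists t, root q t.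
  by apply/closed_rootP; apply: contraNneq pq => ->; rewrite dvdn0.
have tK := q_cl t qt.
have [m m_min] := minimal_poly_exists (algebraic_above tK).
have [m1 mE mt minm] := m_min; have m_gt1 := minimal_poly_size_gt1 m_min.
have [pm|pm] := boolP (p %| (size m).-1)%N; last first.
  by exists t => //; apply: minimal_poly_deg1 m_min pm.
have [g def_q] := dvdpP _ _ (minm q qE qt).
have m0 := monic_neq0 m1.
have g0 : g != 0 by apply: contraNneq q0 => g0; rewrite def_q g0 mul0r.
have gE : g \is a polyOver E.
  have -> : g = q %/ m by rewrite def_q mulpK.
  exact: polyOver_divp.
have sz_q : (size q = size g + (size m).-1)%N.
  by rewrite def_q size_mul //; move: m_gt1; case: (size m) => // k; rewrite addnS.
have lt_g : (size g < n)%N by lia.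
have g_cl x : root g x -> x \in alg_closure K.
  by move=> gx; apply: q_cl; rewrite def_q rootM gx.
have pg : ~~ (p %| (size g).-1)%N.
  apply: contra pq; rewrite sz_q => pg.
  have : (0 < size g)%N by rewrite size_poly_gt0.
  case: (size g) pg => // k pk _; rewrite addSn /=; exact: dvdn_add.
have [x xE gx] := IH g lt_g g0 gE g_cl pg.
by exists x => //; rewrite def_q rootM gx.
Qed.

(** The minimal polynomial of [t] divides (X - t)^p and is separable, hence linear. *)
Lemma perfect_above t : t \in alg_closure K -> t ^+ p \in E -> t \in E.
Proof.
move=> tK tpE; have p_pr := pcharf_prime pL.
have [m m_min] := minimal_poly_exists (algebraic_above tK).
have [m1 mE mt minm] := m_min; have m_gt1 := minimal_poly_size_gt1 m_min.
have pP : p \in [pchar {poly L}] by rewrite pchar_poly.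
have def_Xp : 'X ^+ p - (t ^+ p)%:P = ('X - t%:P) ^+ p.
  by rewrite -(pFrobenius_autE pP ('X - _)) (rmorphB (pFrobenius_aut pP)) /=
    !pFrobenius_autE rmorphXn.
have m_dvd : m %| ('X - t%:P) ^+ p.
  rewrite -def_Xp; apply: minm; first by rewrite rpredB ?polyOverXn ?polyOverC.
  by rewrite rootE !hornerE subrr.
have [r def_m] := closed_field_poly_normal m.
have {}def_m : m = \prod_(z <- r) ('X - z%:P).
  by rewrite {1}def_m (monicP m1) scale1r.
have r_t z : z \in r -> z = t.
  rewrite -root_prod_XsubC -def_m => /(root_dvdp m_dvd).
  by rewrite rootE horner_exp hornerXsubC expf_eq0 subr_eq0 => /andP[_ /eqP].
have := minimal_poly_separable t KE tK m_min.
move: m_gt1 def_m r_t; case: r => [|z [|y r]].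
- by rewrite big_nil => + m_1; rewrite m_1 size_poly1.
- rewrite big_seq1 => _ def_m /(_ z (mem_head _ _)) <- _.
  by have := polyOverP mE 0%N; rewrite def_m coefB coefX coefC sub0r rpredN.
move=> _ def_m r_t; case/negP.
rewrite def_m !big_cons (r_t z) ?mem_head // (r_t y) ?inE ?eqxx ?orbT //.
by rewrite mulrA -expr2 dvdp_mulr.
Qed.

End Intermediate.
End RamifiedConjugates.

(** * Artin-Schreier subextensions *)

Lemma sum_cyclic_shift (V : zmodType) n (f : nat -> V) :
  f n = f 0%N -> \sum_(i < n) f i.+1 = \sum_(i < n) f i.
Proof.
move=> fn; apply: (addrI (f 0%N)).
by rewrite -(big_ord_recl n (fun i => f i)) big_ord_recr /= fn addrC.
Qed.

Section ArtinSchreier.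
Variables (L : closedFieldType) (G : orderedGroupType) (w : L -> value G).
Variables (p : nat) (K E : divringClosed L).
Hypotheses (vw : valuation w) (pL : p \in [pchar L]).
Hypothesis K_conj : ramified_conjugates w K.
Hypotheses (KE : {subset K <= E}) (EK : {subset E <= alg_closure K}).
Implicit Types (a b c s t x y : L) (f g h m q : {poly L}).

(* Compare dimensions over [E]: [E(y)] is a subspace of [E(b)]. *)
Lemma generator_of_large_degree b m h m' : minimal_poly E b m ->
  h \is a polyOver E -> minimal_poly E h.[b] m' -> (size m <= size m')%N ->
  exists2 r, r \is a polyOver E & r.[h.[b]] = b.
Proof.
move=> m_min hE m'_min le_mm'; have [m1 mE mb _] := m_min.
have m0 := monic_neq0 m1; have [m'1 m'E _ minm'] := m'_min.
pose vE : {rmorphism subfield_type E -> L} := \val.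
have [h' /esym def_h] : exists h' : {poly subfield_type E}, h = map_poly vE h' by apply: polyOver_lift.
have [m_ /esym def_m] : exists m_ : {poly subfield_type E}, m = map_poly vE m_ by apply: polyOver_lift.
have eval_mod (f : {poly subfield_type E}) :
    (map_poly vE (f %% m_)).[b] = (map_poly vE f).[b].
  rewrite [in RHS](divp_eq f m_) rmorphD rmorphM /= hornerD hornerM.
  by rewrite def_m (rootP mb) mulr0 add0r.
have sz_m : size m = size m_ by rewrite -def_m (size_map_poly vE).
have m_0 : m_ != 0 by rewrite -(map_poly_eq0 vE) def_m.
pose n := (size m_).-1.
have n_S : size m_ = n.+1 by rewrite prednK // size_poly_gt0.
(* Row i holds the coordinates of h(b)^i with respect to 1, b, ..., b^(n-1). *)
pose M := \matrix_(i < n) poly_rV (h' ^+ i %% m_) : 'M_n.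
have rowM (v : 'rV_n) : (map_poly vE (rVpoly (v *m M))).[b] = (map_poly vE (rVpoly v)).[h.[b]].
  rewrite mulmx_sum_row linear_sum /= (rmorph_sum (map_poly vE)) horner_sum.
  rewrite [in RHS](@horner_coef_wide _ n); last first.
    by rewrite (size_map_poly vE) size_poly.
  apply: eq_bigr => i _; rewrite linearZ /= rowK poly_rV_K; last first.
    by rewrite -ltnS -n_S ltn_modp.
  rewrite (map_polyZ vE) hornerZ eval_mod (coef_map vE) coef_rVpoly_ord.
  by rewrite rmorphXn /= def_h horner_exp.
(* A vector in the left kernel is a polynomial of degree less than n that vanishes at h(b), so [m']
   divides it; since deg m' >= n, it is zero. *)
have M_unit : M \in unitmx.
  rewrite -row_free_unit; apply: inj_row_free => v vM0.
  have := rowM v; rewrite vM0 linear0 rmorph0 horner0 => /esym/eqP v_y.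
  have := minm' _ (polyOver_map _) v_y.
  have [v0 _|v0 /dvdp_leq] := eqVneq (map_poly vE (rVpoly v)) 0.
    apply/rowP => i; rewrite mxE -coef_rVpoly_ord; move/eqP: v0.
    by rewrite (map_poly_eq0 vE) => /eqP ->; rewrite coef0.
  rewrite v0 (size_map_poly vE) => /(_ isT) le_m'.
  have := leq_trans le_mm' (leq_trans le_m' (size_poly _ _)).
  by rewrite sz_m n_S ltnn.
exists (map_poly vE (rVpoly (poly_rV ('X %% m_) *m invmx M))).
  exact: polyOver_map.
rewrite -rowM mulmxKV // poly_rV_K; last by rewrite -ltnS -n_S ltn_modp.
by rewrite eval_mod map_polyX hornerX.
Qed.


(* [g] induces the automorphism of [E(b)] over [E] that maps [b] to [g(b)], and
   [E(b)] has no proper subextension; the successive images of [b] under this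
   automorphism form a finite cycle. *)
Section PrimeCycle.
Variables (b : L) (m g : {poly L}).
Hypotheses (bK : b \in alg_closure K) (bE : b \notin E) (m_min : minimal_poly E b m).
Hypotheses (gE : g \is a polyOver E) (mg : root m g.[b]) (gb : g.[b] != b).
Hypothesis generator : forall h, h \is a polyOver E -> h.[b] \notin E ->
  exists2 r, r \is a polyOver E & r.[h.[b]] = b.

Let minm h : h \is a polyOver E -> root h b -> m %| h.
Proof. by have [_ _ _ minm] := m_min; apply: minm. Qed.

(* Hence the fixed field of any nontrivial automorphism of [E(b)] is [E]. *)
Lemma conj_fixed h s : h \is a polyOver E -> root m s -> s != b ->
  h.[s] = h.[b] -> h.[b] \in E.
Proof.
move=> hE ms sb hsb; apply: contraNT sb => /(generator hE)[r rE rb].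
have : m %| 'X - (r \Po h).
  apply: minm; first by rewrite rpredB ?polyOverX ?polyOver_comp.
  by rewrite rootE hornerD hornerN hornerX horner_comp rb subrr.
move=> /root_dvdp/(_ ms); rewrite rootE hornerD hornerN hornerX horner_comp.
by rewrite hsb rb subr_eq0.
Qed.

Let cycle k := iter k (horner g) b.
(** The iterate as a polynomial in [b], to be evaluated at other conjugates as well. *)
Let cycle_poly k := iter k (fun f => g \Po f) 'X.

Let cycle_polyE k x : (cycle_poly k).[x] = iter k (horner g) x.
Proof. by elim: k => [|k IH]; rewrite ?hornerX //= horner_comp IH. Qed.

Let cycle_polyOver k : cycle_poly k \is a polyOver E.
Proof. by elim: k => [|k IH]; rewrite ?polyOverX //= polyOver_comp. Qed.

Let root_g s : root m s -> root m g.[s].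
Proof.
have [_ mE _ _] := m_min.
have : m %| m \Po g by apply: minm; rewrite ?polyOver_comp // rootE horner_comp.
by move=> /root_dvdp mmg /mmg; rewrite rootE horner_comp.
Qed.

Let root_cycle k : root m (cycle k).
Proof. by have [_ _ mb _] := m_min; elim: k => //= k /root_g. Qed.

(** If s were in [E], irreducibility would make [m] linear, and b = s. *)
Lemma conj_not_in_base s : root m s -> s \notin E.
Proof.
move=> ms; apply: contra bE => sE; have [m1 mE mb _] := m_min.
have m_X : m = m %/ ('X - s%:P) * ('X - s%:P) by rewrite divpK // dvdp_XsubCl.
have XE : 'X - s%:P \is a polyOver E by rewrite polyOverXsubC.
have qE := polyOver_divp mE XE.
have [/eqP/size_poly1P[c c0 q_c]|] := minimal_poly_irreducible m_min qE XE m_X.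
  move: mb; rewrite m_X q_c rootM rootC (negPf c0) root_XsubC.
  by move=> /eqP ->.
by rewrite size_XsubC.
Qed.

(** The iterates stay among the finitely many roots of [m], so two of them agree; the polynomial
    [r], inverse to [g] on these roots, takes the coincidence back to [b]. *)
Lemma cycle_periodic : exists k, (0 < k)%N && (cycle k == b).
Proof.
have [r rE rg] := generator gE (conj_not_in_base mg).
have rK s : root m s -> r.[g.[s]] = s.
  move=> ms; have : m %| 'X - (r \Po g).
    apply: minm; first by rewrite rpredB ?polyOverX ?polyOver_comp.
    by rewrite rootE hornerD hornerN hornerX horner_comp rg subrr.
  move=> /root_dvdp/(_ ms); rewrite rootE hornerD hornerN hornerX horner_comp.
  by rewrite subr_eq0 => /eqP.
have [rts def_m] := closed_field_poly_normal m.
have [m1 _ _ _] := m_min.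
have mP s : root m s = (s \in rts).
  by rewrite def_m (monicP m1) scale1r root_prod_XsubC.
pose c := [seq cycle i | i <- iota 0 (size rts).+1].
have sub_c : {subset c <= rts} by move=> _ /mapP[i _ ->]; rewrite -mP.
have /(uniqPn 0)[i [j []]] : ~~ uniq c.
  apply/negP => /uniq_leq_size/(_ sub_c); rewrite size_map size_iota.
  by rewrite ltnn.
rewrite size_map size_iota => lt_ij lt_j.
rewrite !(nth_map 0%N) ?size_iota ?(ltn_trans lt_ij) // !nth_iota ?(ltn_trans lt_ij) //.
rewrite !add0n => eq_ij; exists (j - i)%N; rewrite subn_gt0 lt_ij /=.
have back k l : cycle k = cycle (k + l) -> cycle l = b.
  elim: k => [<- //|k IH]; rewrite addSn => /(congr1 (horner r)).
  rewrite [cycle k.+1]iterS [cycle (k + l).+1]iterS !rK; [exact: IH | exact: root_cycle | exact: root_cycle].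
by rewrite (back i (j - i)%N) // subnKC // ltnW.
Qed.

(** Let N be the order of the automorphism. A trace argument gives that [p] divides N, so its power
    of exponent N/p has order [p]. Hilbert 90 yields an element that this power shifts by 1; then
    h(b)^p - h(b) is fixed, hence in [E]. *)
Lemma artin_schreier_of_conj :
  exists2 h, h \is a polyOver E & h.[b] \notin E /\ h.[b] ^+ p - h.[b] \in E.
Proof.
have p_pr := pcharf_prime pL.
case: (ex_minnP cycle_periodic) => N /andP[N0 /eqP cN] minN.
have cycleD i j : cycle (i + j) = iter i (horner g) (cycle j).
  by rewrite /cycle iterD.
have Nmin i : (0 < i < N)%N -> cycle i != b.
  move=> /andP[i0 iN]; apply/eqP => ci.
  by have := minN i; rewrite i0 ci eqxx => /(_ isT); rewrite leqNgt iN.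
(* Otherwise [b - Tr(b) / N] has trace 0, although all its conjugates have the
   same leading term. *)
have pN : (p %| N)%N.
  apply: contraT => pN; have N0L : N%:R != 0 :> L by rewrite -(dvdn_pcharf pL).
  pose Tr := \sum_(i < N) cycle_poly i.
  have TrE : Tr \is a polyOver E by apply: rpred_sum => i _; apply: cycle_polyOver.
  have Tr_b : Tr.[b] = \sum_(i < N) cycle i.
    by rewrite horner_sum; apply: eq_bigr => i _; rewrite cycle_polyE.
  have tE : Tr.[b] \in E.
    apply: (@conj_fixed _ g.[b]) => //; rewrite Tr_b horner_sum.
    have -> : \sum_(i < N) (cycle_poly i).[g.[b]] = \sum_(i < N) cycle i.+1.
      by apply: eq_bigr => i _; rewrite cycle_polyE -iterSr.
    exact: sum_cyclic_shift.
  pose e := Tr.[b] / N%:R.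
  have eE : e \in E by rewrite rpred_div ?rpred_nat.
  have be0 : b - e != 0 by rewrite subr_eq0; apply: contraNneq bE => ->.
  have : \sum_(i <- iota 0 N) (cycle i - e) != 0.
    apply: (sum_neq0 vw pL be0) => [i _|]; last by rewrite size_iota.
    have := @val_conj_gt _ _ _ K K_conj E b m ('X - e%:P) (cycle i) KE m_min.
    rewrite !hornerXsubC; apply=> //; first by rewrite polyOverXsubC.
    by rewrite rpredB // EK.
  rewrite sumrB big_const_seq count_predT iter_addr_0 size_iota -mulr_natr divfK //.
  by rewrite Tr_b -(big_mkord xpredT) /index_iota subn0 subrr eqxx.
(* Additive Hilbert 90 for the automorphism of order [p], with orbit [s]. *)
pose M := (N %/ p)%N; have N_M : N = (M * p)%N by rewrite divnK.
have M0 : (0 < M)%N by move: N0; rewrite N_M; case: (M).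
pose s i := cycle (i * M); pose S i := cycle_poly (i * M).
have S_b i : (S i).[b] = s i by rewrite cycle_polyE.
have S_s1 i : (S i).[s 1%N] = s i.+1.
  by rewrite cycle_polyE -cycleD -mulnDl addn1.
have SE i : S i \is a polyOver E by apply: cycle_polyOver.
have s_p : s p = s 0%N by rewrite /s mulnC -N_M cN.
have s_b i : (0 < i < p)%N -> s i != b.
  move=> /andP[i0 ip]; apply: Nmin; rewrite muln_gt0 i0 M0 N_M mulnC ltn_mul2l.
  by rewrite M0.
have s1b : s 1%N != b by apply: s_b; rewrite prime_gt1.
have ms1 : root m (s 1%N) by apply: root_cycle.
(* If all power sums vanished, so would the sum of f(s_i) for every polynomial f. Taking f with
   roots s_1, ..., s_(p-1) but not s_0 = b gives a contradiction. *)
have [j Tj] : exists j, \sum_(i < p) s i ^+ j != 0.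
  apply: contrapT => /forallNP T0.
  have T0f f : \sum_(i < p) f.[s i] = 0.
    rewrite (eq_bigr (fun i : 'I_p => \sum_(j < size f) f`_j * s i ^+ j)); last first.
      by move=> i _; rewrite horner_coef.
    rewrite exchange_big big1 // => k _; rewrite -mulr_sumr.
    by move: (T0 k) => /negP; rewrite negbK => /eqP ->; rewrite mulr0.
  have := T0f (\prod_(1 <= i < p) ('X - (s i)%:P)).
  case: (p) p_pr s_b => // q _ s_b; rewrite big_ord_recl [X in _ + X]big1 ?addr0 => [|i _].
    rewrite horner_prod => /eqP; rewrite prodf_seq_eq0 => /hasP[i].
    rewrite mem_index_iota /= hornerXsubC subr_eq0 eq_sym => /s_b/negPf.
    by rewrite /s mul0n /= => ->.
  apply/eqP; rewrite -rootE -dvdp_XsubCl.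
  by rewrite (bigD1_seq (bump 0 i)) ?iota_uniq ?mem_index_iota ?dvdp_mulr //= ltnS ltn_ord.
pose T := \sum_(i < p) s i ^+ j.
pose TP := \sum_(i < p) S i ^+ j.
have TP_b : TP.[b] = T.
  by rewrite horner_sum; apply: eq_bigr => i _; rewrite horner_exp S_b.
have sum_shift : \sum_(i < p) s i.+1 ^+ j = T.
  by apply: (sum_cyclic_shift (f := fun i => s i ^+ j)); rewrite s_p.
have TE : T \in E.
  rewrite -TP_b; apply: (@conj_fixed _ (s 1%N)) => //.
    by apply: rpred_sum => i _; apply: rpredX.
  rewrite TP_b horner_sum -sum_shift.
  by apply: eq_bigr => i _; rewrite horner_exp S_s1.
pose h := - T^-1 *: \sum_(i < p) i%:R *: S i ^+ j.
have hE : h \is a polyOver E.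
  rewrite polyOverZ ?rpredN ?rpredV // rpred_sum // => i _.
  by rewrite polyOverZ ?rpred_nat ?rpredX.
have h_b : h.[b] = - T^-1 * \sum_(i < p) i%:R * s i ^+ j.
  rewrite hornerZ horner_sum; congr (_ * _); apply: eq_bigr => i _.
  by rewrite hornerZ horner_exp S_b.
have h_s1 : h.[s 1%N] = h.[b] + 1.
  have -> : h.[s 1%N] = - T^-1 * \sum_(i < p) i%:R * s i.+1 ^+ j.
    rewrite hornerZ horner_sum; congr (_ * _); apply: eq_bigr => i _.
    by rewrite hornerZ horner_exp S_s1.
  have -> : \sum_(i < p) i%:R * s i.+1 ^+ j = \sum_(i < p) i%:R * s i ^+ j - T.
    rewrite -sum_shift; apply/eqP; rewrite eq_sym subr_eq -big_split /=; apply/eqP.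
    rewrite [RHS](eq_bigr (fun i : 'I_p => i.+1%:R * s i.+1 ^+ j)); last first.
      by move=> i _; rewrite -[in RHS]natr1 mulrDl mul1r.
    (* The weighted sum may be shifted cyclically because the weight p is 0 in [L]. *)
    symmetry; apply: (sum_cyclic_shift (f := fun i => i%:R * s i ^+ j)).
    by rewrite (pcharf0 pL) !mul0r.
  by rewrite mulrBr mulNr mulNr mulVf // opprK h_b mulNr.
exists h => //; split.
  apply/negP => hbE; have : m %| h - h.[b]%:P.
    apply: minm; first by rewrite rpredB ?polyOverC.
    by rewrite rootE hornerD hornerN hornerC subrr.
  move=> /root_dvdp/(_ ms1); rewrite rootE hornerD hornerN hornerC h_s1.
  by rewrite addrAC subrr add0r oner_eq0.
have -> : h.[b] ^+ p - h.[b] = (h ^+ p - h).[b] by rewrite hornerD hornerN horner_exp.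
apply: (@conj_fixed _ (s 1%N)) => //; first by rewrite rpredB ?rpredX.
rewrite !hornerD !hornerN !horner_exp h_s1.
rewrite -(pFrobenius_autE pL) rmorphD rmorph1 /= pFrobenius_autE.
by rewrite opprD addrACA subrr addr0.
Qed.

End PrimeCycle.

(* Take [b] of minimal degree over [E] in [E(a)] outside [E]. Its degree is divisible
   by [p], so over [E(b)] the other factors of its minimal polynomial cannot all
   have degree divisible by [p]: there is another conjugate in [E(b)]. *)
Lemma artin_schreier_exists a : a \in alg_closure K -> a \notin E ->
  exists2 h, h \is a polyOver E & h.[a] \notin E /\ h.[a] ^+ p - h.[a] \in E.
Proof.
move=> aK aE; have p_pr := pcharf_prime pL.
have hK h x : h \is a polyOver E -> x \in alg_closure K -> h.[x] \in alg_closure K.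
  move=> hE xK; apply: rpred_horner => //.
  by apply/polyOverP => i; apply/EK/(polyOverP hE).
have minpoly_ex x : x \in alg_closure K -> exists m, minimal_poly E x m.
  by move=> xK; apply/minimal_poly_exists/(algebraic_above KE).
pose Q n := `[< exists h m, [/\ h \is a polyOver E, h.[a] \notin E,
  minimal_poly E h.[a] m & size m = n] >].
have exQ : exists n, Q n.
  have [m m_min] := minpoly_ex a aK.
  by exists (size m); apply/asboolP; exists 'X, m; rewrite polyOverX hornerX.
case: (ex_minnP exQ) => n /asboolP[h [m [hE bE m_min sz_m]]] n_min.
set b := h.[a] in bE m_min.
have bK : b \in alg_closure K by apply: hK.
have generator k : k \is a polyOver E -> k.[b] \notin E ->
    exists2 r, r \is a polyOver E & r.[k.[b]] = b.
  move=> kE kbE; have [m' m'_min] := minpoly_ex _ (hK _ _ kE bK).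
  apply: (generator_of_large_degree m_min kE m'_min).
  rewrite sz_m; apply: n_min; apply/asboolP; exists (k \Po h), m'.
  by rewrite horner_comp polyOver_comp.
have [m1 mE mb _] := m_min.
have pm : (p %| (size m).-1)%N.
  by apply: contraNT bE => /(minimal_poly_deg1 vw pL K_conj KE EK bK m_min).
have bC : b \in alg_closure E by apply/alg_closureP/(algebraic_above KE).
pose E' := simple_ext bC.
have EE' : {subset E <= E'}.
  by move=> x xE; apply/simple_extP; exists x%:P; rewrite ?polyOverC ?hornerC.
have KE' : {subset K <= E'} by move=> x /KE/EE'.
have E'K : {subset E' <= alg_closure K} by move=> _ /simple_extP[k kE ->]; apply: hK.
pose q := m %/ ('X - b%:P).
have def_m : m = q * ('X - b%:P) by rewrite divpK // dvdp_XsubCl.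
have q0 : q != 0.
  by apply: contraNneq (monic_neq0 m1) => q0; rewrite def_m q0 mul0r.
have qE' : q \is a polyOver E'.
  apply: polyOver_divp; first by apply/polyOverP => i; apply/EE'/(polyOverP mE).
  by rewrite polyOverXsubC; apply/simple_extP; exists 'X; rewrite ?polyOverX ?hornerX.
have q_cl x : root q x -> x \in alg_closure K.
  move=> qx; have mx : root m x by rewrite def_m rootM qx.
  have /alg_closureP[P [P0 PK Pb]] := bK.
  apply/alg_closureP; exists P; split=> //.
  have [_ _ _ minm] := m_min; apply: root_dvdp mx; apply: minm => //.
  by apply/polyOverP => i; apply/KE/(polyOverP PK).
have sz_q : size m = (size q).+1 by rewrite def_m size_Mmonic ?monicXsubC // size_XsubC addn2.
(* deg q = deg m - 1, and [p] divides deg m. *)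
have pq : ~~ (p %| (size q).-1)%N.
  move: pm; rewrite sz_q /=; move: q0; rewrite -size_poly_gt0.
  case: (size q) => // k _ /= pk; apply/negP => pk'.
  have := pk; rewrite -addn1 dvdn_addr // dvdn1 => /eqP p1.
  by rewrite p1 in p_pr.
have [_ /simple_extP[g gE ->] qb'] := root_of_degree_prime_to_p vw pL K_conj KE' E'K q0 qE' q_cl pq.
have mg : root m g.[b] by rewrite def_m rootM qb'.
(* Otherwise [b] would be a double root of the separable polynomial [m]. *)
have gb : g.[b] != b.
  apply/eqP => gb; have := minimal_poly_separable K_conj b KE bK m_min.
  by rewrite def_m expr2 dvdp_mul2r ?polyXsubC_eq0 // dvdp_XsubCl -gb qb'.
have [k kE [kbE kb]] := artin_schreier_of_conj bK bE m_min gE mg gb generator.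
by exists (k \Po h); rewrite ?polyOver_comp // horner_comp.
Qed.

End ArtinSchreier.

(** * Residue fields and value groups *)

Lemma exprB_pchar (R : comNzRingType) p (x y : R) k : p \in [pchar R] ->
  (x - y) ^+ (p ^ k) = x ^+ (p ^ k) - y ^+ (p ^ k).
Proof.
move=> pR; elim: k => [|k IH]; first by rewrite !expr1.
by rewrite expnSr !exprM IH -(pFrobenius_autE pR) rmorphB /= !pFrobenius_autE.
Qed.

Section Residues.
Variables (L : closedFieldType) (G : orderedGroupType) (w : L -> value G).
Variables (p : nat) (K : divringClosed L).
Hypotheses (vw : valuation w) (pL : p \in [pchar L]).
Hypothesis K_conj : ramified_conjugates w K.
Hypothesis K_perfect : forall x, x \in K -> exists2 y, y \in K & y ^+ p = x.
Implicit Types (a b c s t x y : L) (f g h m q : {poly L}).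

(** Modulo the maximal ideal each factor equals X - a. Integrality of the coefficients is carried
    along to control the products in the induction. *)
Lemma coef_prodXsubC_close a (r : seq L) : w 1 <= w a ->
    (forall c, c \in r -> w 1 < w (c - a)) ->
  forall i, w 1 <= w (\prod_(c <- r) ('X - c%:P))`_i /\
    w 1 < w ((\prod_(c <- r) ('X - c%:P))`_i - (('X - a%:P) ^+ size r)`_i).
Proof.
move=> a_ge; elim: r => [|c r IH] ra i.
  rewrite big_nil subrr val0 // coef1 val1 //; split=> //.
  by rewrite -(val1 vw); apply: val_nat_ge.
have ca : w 1 < w (c - a) by apply: ra; rewrite mem_head.
have {}IH j := IH (fun d dr => ra d (mem_behead (s := c :: r) dr)) j.
have c_ge : w 1 <= w c by rewrite -(subrK a c); apply: valD_ge => //; apply: ltW.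
rewrite big_cons [size _]/= exprS; set P := \prod_(_ <- _) _ in IH *; set Q := _ ^+ _ in IH *.
have hd_ge : w 1 <= w (if (i == 0)%N then 0 else P`_i.-1).
  by case: (i == 0)%N; [rewrite val0 ?val1 | have [] := IH i.-1].
have hd_gt : w 1 < w ((if (i == 0)%N then 0 else P`_i.-1) - (if (i == 0)%N then 0 else Q`_i.-1)).
  by case: (i == 0)%N; [rewrite subrr val0 ?val1 | have [] := IH i.-1].
have [P_ge PQ] := IH i.
have mul_ge x y : w 1 <= w x -> w 1 <= w y -> w 1 <= w (x * y).
  by move=> x1 y1; apply: le_trans x1 _; rewrite -{1}[x]mulr1; apply: valM_le.
have mul_gt x y : w 1 <= w x -> w 1 < w y -> w 1 < w (x * y).
  by move=> x1 y1; apply: lt_le_trans y1 _; rewrite -{1}[y]mul1r mulrC [x * y]mulrC; apply: valM_le.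
rewrite !mulrBl !coefB !coefXM !coefCM.
split; first by apply: valB_ge => //; apply: mul_ge.
set P1 := if _ then _ else P`_ _ in hd_ge hd_gt *; set Q1 := if _ then _ else _ in hd_gt *.
have -> : P1 - c * P`_i - (Q1 - a * Q`_i) = (P1 - Q1) - (P`_i * (c - a)  + a * (P`_i - Q`_i)).
  by ring.
by apply: valB_gt => //; apply: valD_gt => //; apply: mul_gt.
Qed.

Lemma perfect_pow k x : x \in K -> exists2 y, y \in K & y ^+ (p ^ k) = x.
Proof.
move=> xK; elim: k => [|k [y yK <-]]; first by exists x; rewrite ?expr1.
by have [z zK <-] := K_perfect yK; exists z; rewrite // expnS exprM.
Qed.

(* If [a] has [n = p^k m] conjugates, with [m] prime to [p], its conjugate
   polynomial is congruent to [(X^(p^k) - a^(p^k))^m], whose second coefficient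
   gives the residue of [a^(p^k)]. *)
Lemma residue_closure a : a \in alg_closure K -> w 1 <= w a ->
  exists2 c, c \in K & w 1 < w (a - c).
Proof.
move=> aK a_ge; have [a0|a0] := eqVneq a 0.
  by exists 0; rewrite ?rpred0 // a0 subrr val0 ?val1.
have [r [_ ar PK r_gt]] := K_conj aK; have p_pr := pcharf_prime pL.
have p_prL : p \in [pchar {poly L}] by rewrite pchar_poly.
pose n := size r; have n0 : (0 < n)%N by rewrite /n; case: (r) ar.
pose k := logn p n; have [m pm def_n] := pfactor_coprime p_pr n0.
rewrite -/k in def_n.
have m0 : (0 < m)%N by move: n0; rewrite def_n; case: (m).
have {}pm : ~~ (p %| m)%N by rewrite -prime_coprime.
have close c : c \in r -> w 1 < w (c - a).
  by move=> cr; apply: le_lt_trans a_ge _; apply: r_gt.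
pose c0 := (\prod_(c <- r) ('X - c%:P))`_(p ^ k * m.-1).
have [_] := coef_prodXsubC_close a_ge close (p ^ k * m.-1)%N; rewrite -/c0.
have c0K : c0 \in K by apply: (polyOverP PK).
have -> : (('X - a%:P) ^+ size r)`_(p ^ k * m.-1) = - (m%:R * a ^+ (p ^ k)).
  rewrite -/n def_n mulnC exprM exprB_pchar // -polyC_exp.
  have -> : 'X ^+ (p ^ k) - (a ^+ (p ^ k))%:P = ('X - (a ^+ (p ^ k))%:P) \Po 'X^(p ^ k).
    by rewrite comp_polyB comp_polyX comp_polyC.
  rewrite -rmorphXn /= coef_comp_poly_Xn ?expn_gt0 ?prime_gt0 //.
  rewrite dvdn_mulr // mulKn ?expn_gt0 ?prime_gt0 //.
  set s := a ^+ (p ^ k).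
  have -> : ('X - s%:P) ^+ m = \prod_(c <- nseq m s) ('X - c%:P).
    by rewrite big_nseq iter_mulr_1.
  have := @coefPn_prod_XsubC _ (nseq m s); rewrite size_nseq -lt0n => -> //.
  by rewrite big_nseq iter_addr_0 mulr_natl.
rewrite opprK => c0_gt.
have m0L : m%:R != 0 :> L by rewrite -(dvdn_pcharf pL).
(* [d] is a p^k-th root of -c0/m, so c0 + m a^(p^k) = m (a - d)^(p^k). *)
have [d dK d_c0] := perfect_pow k (rpred_div (rpredNr c0K) (rpred_nat K m)).
exists d => //; rewrite ltNge; apply/negP => ad_le.
suff : w 1 < w 1 by rewrite ltxx.
apply: lt_le_trans c0_gt _.
have -> : c0 + m%:R * a ^+ (p ^ k) = m%:R * (a - d) ^+ (p ^ k).
  by rewrite exprB_pchar // d_c0 mulrBr mulrCA mulfV // mulr1 opprK addrC.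
rewrite (valuationM vw) (val_natr vw pL pm) -(valuationM vw) mul1r.
rewrite -[X in _ <= w X](expr1n _ (p ^ k)).
exact: valX_le.
Qed.

End Residues.

(** * Values and residues in the algebraic closure of an immediate extension *)

Section ImmediateExtension.
Variables (L : closedFieldType) (G : orderedGroupType) (w : L -> value G).
Variables (p : nat) (K F : divringClosed L).
Hypotheses (vw : valuation w) (pL : p \in [pchar L]).
Hypothesis F_val : forall x, x \in F -> exists2 c, c \in K & w c = w x.
Hypothesis F_alg : forall x, algebraic F x.
Implicit Types (a b c s t x y : L) (f g h m q : {poly L}).

(** In an equation of [y] over [F], two terms must share the minimal value; comparing them puts the
    value of a power of [y] in vF = vK. *)
Lemma value_torsion y : y != 0 ->
  exists n x, [/\ (0 < n)%N, x \in K, x != 0 & w (y ^+ n) = w x].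
Proof.
move=> y0; have [q [q0 qF qy]] := F_alg y.
pose n := size q; pose t (i : 'I_n) := q`_i * y ^+ i.
have n0 : (0 < n)%N by rewrite size_poly_gt0.
have lt_max : (n.-1 < n)%N by rewrite ltn_predL.
pose imax := Ordinal lt_max.
have [i _ imin] := @arg_minP _ _ _ imax xpredT (fun i => w (t i)) isT.
have ti0 : t i != 0.
  apply/eqP => ti0; have := imin imax isT; rewrite ti0 val0 //.
  have : t imax != 0 by rewrite mulf_neq0 ?expf_neq0 // -lead_coefE lead_coef_eq0.
  by move=> /(val_Some vw)[g ->].
have [j ji tj] : exists2 j, j != i & w (t j) = w (t i).
  apply: contrapT => no_j; have := rootP qy; rewrite horner_coef (bigD1 i) //= => /eqP.
  rewrite addr_eq0 -[_ * _]/(t i) => /eqP ti_sum.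
  have : w (t i) < w (\sum_(j < n | j != i) t j).
    apply: val_sum_gt => // j ji; rewrite lt_neqAle imin // andbT.
    by apply/eqP => tj; apply: no_j; exists j.
  by rewrite -(valN vw) ti_sum opprK ltxx.
have main (k l : 'I_n) : (k < l)%N -> w (t k) = w (t l) -> w (t k) != w 0 ->
    exists n x, [/\ (0 < n)%N, x \in K, x != 0 & w (y ^+ n) = w x].
  move=> lt_kl tkl tk0.
  have qk0 : q`_k != 0.
    by apply: contraNneq tk0 => qk; rewrite /t qk mul0r.
  have ql0 : q`_l != 0.
    by rewrite tkl in tk0; apply: contraNneq tk0 => ql; rewrite /t ql mul0r.
  have qklF : q`_k / q`_l \in F by rewrite rpred_div ?(polyOverP qF).
  have [x xK wx] := F_val qklF.
  exists (l - k)%N, x; rewrite subn_gt0; split=> //.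
    apply/eqP => x0; move: wx; rewrite x0 val0 // => /esym/(valuation_eq_None vw)/eqP.
    by rewrite mulf_eq0 invr_eq0 (negPf qk0) (negPf ql0).
  rewrite wx; have -> : y ^+ (l - k)%N = t l * ((q`_l)^-1 * y ^- k).
    rewrite /t mulrACA mulfV // mul1r -{2}(subnK (ltnW lt_kl)) exprD mulfK //.
    by rewrite expf_neq0.
  rewrite (valM_eq vw (esym tkl) (erefl _)) /t mulrACA mulfV ?mulr1 //.
  by rewrite expf_neq0.
have ti0' : w (t i) != w 0.
  by rewrite val0 //; have [g ->] := val_Some vw ti0.
case: (ltngtP i j) => [ij|ij|/val_inj ij]; last by rewrite ij eqxx in ji.
  by apply: (main i j).
by apply: (main j i) => //; rewrite tj.
Qed.

Section RankOne.
Hypothesis K_arch : forall x y, x \in K -> y \in K -> x != 0 -> y != 0 ->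
  w x < w 1 -> exists n, w (x ^+ n) <= w y.

(* If [w u < 0], the powers of [u] would have arbitrarily small values. *)
Lemma val_ge1_of_powers u t : t != 0 -> (forall k, w t <= w (u ^+ (p ^ k))) ->
  w 1 <= w u.
Proof.
move=> t0 tu; rewrite leNgt; apply/negP => u_lt.
have u0 := val_lt_neq0 vw u_lt; have p_pr := pcharf_prime pL.
have [n [x [n0 xK x0 wx]]] := value_torsion u0.
have [m [y [m0 yK y0 wy]]] := value_torsion t0.
have x_lt : w x < w 1 by rewrite -wx -(expr1n _ n); apply: valX_lt.
have [N] := K_arch xK yK x0 y0 x_lt.
rewrite -(valX_eq vw N wx) -wy -exprM => le_ut.
(* With this k, v(u^k) = v(x^N) <= v(t^m) <= v(u^(p^k m)), while p^k m > k and v(u) < 0 give the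
   opposite strict inequality. *)
pose k := (n * N)%N.
have : w (u ^+ (p ^ k * m)) < w (u ^+ k).
  have lt_k : (k < p ^ k * m)%N.
    by apply: leq_trans (ltn_expl k (prime_gt1 p_pr)) _; rewrite leq_pmulr.
  rewrite -(subnKC (ltnW lt_k)) exprD -[X in _ < w X]mulr1 valM_ltE ?expf_neq0 //.
  by rewrite -(expr1n _ (p ^ k * m - k)) valX_lt ?subn_gt0.
rewrite ltNge => /negP; apply; apply: le_trans le_ut _.
by rewrite exprM; apply: valX_le.
Qed.

End RankOne.

Hypothesis K_conj : ramified_conjugates w K.
Hypothesis K_perfect : forall x, x \in K -> exists2 y, y \in K & y ^+ p = x.
Hypothesis F_res : forall x, x \in F -> w 1 <= w x ->
  exists2 c, c \in K & w 1 < w (x - c).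

Lemma val_prod_le1 (I : eqType) (r : seq I) (f : I -> L) :
  (forall i, i \in r -> w (f i) <= w 1) -> w (\prod_(i <- r) f i) <= w 1.
Proof.
move=> f_le; rewrite big_seq; apply: (big_ind (fun x => w x <= w 1)) => // x y x1 y1.
by apply: le_trans x1; rewrite -{2}[x]mulr1; apply: valM_le.
Qed.

(* The residue field of [K] is algebraically closed, so [L] has no larger one. *)
Lemma residue_exists y : w 1 <= w y -> exists2 c, c \in K & w 1 < w (y - c).
Proof.
move=> y_ge; have [q [q0 qF qy]] := F_alg y.
pose n := size q.
have n0 : (0 < n)%N by rewrite size_poly_gt0.
have lt_max : (n.-1 < n)%N by rewrite ltn_predL.
pose imax := Ordinal lt_max.
(* Division by a coefficient of minimal value makes [q] integral with nonzero reduction. *)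
have [i _ imin] := @arg_minP _ _ _ imax xpredT (fun i => w q`_i) isT.
have qi0 : q`_i != 0.
  apply/eqP => qi; have := imin imax isT; rewrite qi val0 //.
  have : q`_imax != 0 by rewrite -lead_coefE lead_coef_eq0.
  by move=> /(val_Some vw)[g ->].
(* Residue 0 is lifted to 0 itself, so every nonzero coefficient of [f], in particular the leading
   one, has value 0. *)
have unit_lift x : x \in F -> w 1 <= w x ->
    exists c, [/\ c \in K, w 1 < w (x - c) & c != 0 -> w c = w 1].
  move=> xF x_ge; have [x_gt|x_le] := ltP (w 1) (w x).
    by exists 0; rewrite rpred0 subr0 eqxx.
  have [c cK xc] := F_res xF x_ge; exists c; split=> // _.
  have wx : w x = w 1 by apply: le_anti; rewrite x_ge x_le.
  have -> : c = x + (c - x) by rewrite addrC subrK.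
  by rewrite (valD_eq vw) // wx valB.
have q_lift (j : 'I_n) :
    exists c, [/\ c \in K, w 1 < w (q`_j / q`_i - c) & c != 0 -> w c = w 1].
  apply: unit_lift; first by rewrite rpred_div ?(polyOverP qF).
  by rewrite -(valM_leE vw _ _ qi0) mulr1 mulrC divfK // imin.
have [c c_lift] := choice q_lift.
pose f := \poly_(j < n) oapp c 0 (insub j).
have f_c (j : 'I_n) : f`_j = c j by rewrite coef_poly ltn_ord valK.
have fK : f \is a polyOver K.
  apply/polyOverP => j; rewrite coef_poly; case: ltnP => [lt_j|_]; last exact: rpred0.
  by rewrite insubT /=; have [] := c_lift (Sub j lt_j).
have f0 : f != 0.
  apply/eqP => f0; have [_ + _] := c_lift i; rewrite -f_c f0 coef0 subr0 divff //.
  by rewrite ltxx.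
have lf : w (lead_coef f) = w 1.
  have lf0 : lead_coef f != 0 by rewrite lead_coef_eq0.
  have lt_sf : ((size f).-1 < n)%N.
    apply: leq_trans (size_poly n (fun j => oapp c 0 (insub j))).
    by rewrite ltn_predL size_poly_gt0.
  have lf_c : lead_coef f = c (Ordinal lt_sf) by rewrite lead_coefE (f_c (Ordinal lt_sf)).
  by have [_ _] := c_lift (Ordinal lt_sf); rewrite -lf_c; apply.
have fy : w 1 < w f.[y].
  have -> : f.[y] = - \sum_(j < n) (q`_j / q`_i - c j) * y ^+ j.
    have -> : \sum_(j < n) (q`_j / q`_i - c j) * y ^+ j = q.[y] / q`_i - f.[y].
      rewrite horner_coef (@horner_coef_wide _ n f) ?size_poly // mulr_suml -sumrB.
      by apply: eq_bigr => j _; rewrite f_c mulrBl mulrAC.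
    by rewrite (rootP qy) mul0r sub0r opprK.
  rewrite valN //; apply: val_sum_gt; rewrite ?oner_neq0 // => j _.
  have [_ cj _] := c_lift j; apply: lt_le_trans cj _.
  rewrite -{1}[_ - _]mulr1; apply: valM_le => //.
  by rewrite -(expr1n _ j); apply: valX_le.
have [r def_f] := closed_field_poly_normal f.
(* If no root had the residue of [y], every factor y - s would have value at most 0, and so would
   f(y). *)
have [s sr ys] : exists2 s, s \in r & w 1 < w (y - s).
  apply: contrapT => no_s; move: fy; rewrite def_f hornerZ (valuationM vw) lf.
  rewrite -(valuationM vw) mul1r horner_prod ltNge => /negP; apply.
  apply: val_prod_le1 => s sr; rewrite hornerXsubC leNgt; apply/negP => ys.
  by apply: no_s; exists s.
have s_ge : w 1 <= w s by rewrite -[s](subKr y); apply: valB_ge => //; apply: ltW.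
have sK : s \in alg_closure K.
  apply/alg_closureP; exists f; split=> //.
  by rewrite def_f rootZ ?lead_coef_eq0 // root_prod_XsubC.
have [e eK se] := residue_closure vw pL K_conj K_perfect sK s_ge.
by exists e => //; rewrite -(subrKA s); apply: valD_gt.
Qed.

End ImmediateExtension.

(** The values lying between n v(x) and -n v(x) for some n form a convex subgroup containing v(x) <>
    0, hence the whole value group. *)
Lemma rank_one_archimedean (L : fieldType) (G : orderedGroupType)
    (w : L -> value G) (A : set L) : valuation w -> subfield A -> rank_one w A ->
  forall x y, x \in A -> y \in A -> x != 0 -> y != 0 -> w x < w 1 ->
  exists n, w (x ^+ n) <= w y.
Proof.
move=> vw sA [_ A_rank] x y; pose K := subfield_of sA.
move=> /set_mem/(subfield_ofP sA) xK /set_mem/(subfield_ofP sA) yK x0 y0 x_lt.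
have inv_le a b : a != 0 -> b != 0 -> w a <= w b -> w b^-1 <= w a^-1.
  move=> a0 b0 ab; rewrite -(valM_leE vw b^-1 a^-1 (mulf_neq0 a0 b0)).
  by rewrite mulfK // [a * b]mulrC mulfK.
have wV a g : a != 0 -> w a = Some g -> w a^-1 = Some (- g).
  move=> a0 wa; have [h wh] : exists h, w a^-1 = Some h by apply: val_Some; rewrite ?invr_eq0.
  rewrite wh; congr Some; apply/eqP; rewrite -addr_eq0; apply/eqP.
  have := valuationM vw a a^-1; rewrite mulfV // val1 // wa wh => -[].
  by rewrite addrC => <-.
have wS a g : w a = Some g -> a != 0.
  by move=> wa; apply/eqP => a0; rewrite a0 val0 in wa.
have xX_le i j : (i <= j)%N -> w (x ^+ j) <= w (x ^+ i).
  move=> /subnKC <-; rewrite exprD -[X in _ <= w X]mulr1; apply: valM_le => //.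
  by rewrite -(expr1n _ (j - i)%N); apply/valX_le/ltW.
pose bounded a := exists n, w (x ^+ n) <= w a /\ w (x ^+ n) <= w a^-1.
pose H : set G := [set g | exists a, [/\ a \in K, w a = Some g & bounded a]].
have H_convex : convex_subgroup (value_group w A) H.
  split=> [g [a [aK wa _]]||g h [a aA wa] [b [bK wb [n [_ xb]]]] g0 gh].
  - by exists a => //; apply/(subfield_ofP sA).
  - split=> [|g h]; rewrite !in_setE.
      exists 1; rewrite rpred1 val1 //; split=> //.
      by exists 0%N; rewrite invr1 expr0 lexx.
    move=> [a [aK wa [n [xa xa']]]] [b [bK wb [k [xb xb']]]].
    exists (a / b); split; first by rewrite rpred_div.
      by rewrite (valuationM vw) wa (wV _ _ (wS _ _ wb) wb).
    have mul_le c d c' d' : w c <= w d -> w c' <= w d' -> w (c * c') <= w (d * d').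
      move=> cd cd'; apply: le_trans (valM_le vw c cd') _.
      by rewrite ![_ * d']mulrC; apply: valM_le.
    by exists (n + k)%N; rewrite invfM invrK exprD; split; apply: mul_le.
  exists a; split=> //; first exact/subfield_ofP.
  have a0 := wS _ _ wa; have b0 := wS _ _ wb.
  exists n; split.
    apply: le_trans (_ : w 1 <= _); first by rewrite -(expr0 x); apply: xX_le.
    by rewrite val1 // wa.
  by apply: le_trans xb (inv_le _ _ a0 b0 _); rewrite wa wb.
have [g wx] := val_Some vw x0.
have Hg : H g.
  exists x; split=> //; exists 1%N; rewrite expr1 lexx; split=> //.
  apply: le_trans (ltW x_lt) _; rewrite -invr1.
  by apply: inv_le; rewrite ?oner_neq0 ?ltW.
have [H0|HA] := A_rank H H_convex.
  have : [set 0] g by rewrite -H0.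
  by move=> /= g0; move: x_lt; rewrite wx g0 val1 // ltxx.
have [h wy] := val_Some vw y0.
have : H h by rewrite HA; exists y => //; apply/(subfield_ofP sA).
by move=> [a [_ wa [n [xa _]]]]; exists n; rewrite wy -wa.
Qed.

(** * Pseudo-limits *)

Section PseudoLimits.
Variables (L : closedFieldType) (G : orderedGroupType) (w : L -> value G).
Variables (d : Order.disp_t) (T : orderType d) (z : T -> L).
Hypotheses (vw : valuation w) (z_pc : pseudo_convergent w z).
Implicit Types (a c x y : L) (f h : {poly L}).

Lemma valB_neq x y : w x != w y -> w (x - y) = Order.min (w x) (w y).
Proof.
move=> xy; have [le_xy|lt_yx] := leP (w x) (w y).
  by apply: valD_eq; rewrite // valN // lt_neqAle xy.
by rewrite valB //; apply: valD_eq; rewrite // valN.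
Qed.

Lemma not_pseudo_limitP y : ~ pseudo_limit w z y ->
  exists i j, is_succ i j /\ w (z i - y) != w (z i - z j).
Proof.
move=> /existsNP[i /existsNP[j /not_implyP[ij /eqP]]].
by rewrite valB //; exists i, j.
Qed.

(** At some i with successor j, v(z_i - y) differs from v(z_i - z_j), which equals v(z_i - z_k) for
    all k >= j; so v(z_k - y) is the minimum of the two. *)
Lemma val_ultimately_constant y : ~ pseudo_limit w z y ->
  exists j, forall k, (j <= k)%O -> w (z k - y) = w (z j - y).
Proof.
move=> /not_pseudo_limitP[i [j [[ij _] yi]]].
have zi k : (j <= k)%O -> w (z i - z k) = w (z i - z j).
  rewrite le_eqVlt => /predU1P[-> //|jk].
  by rewrite -(subrKA (z j)); apply/valD_eq/z_pc.
have zy k : (j <= k)%O -> w (z k - y) = Order.min (w (z i - y)) (w (z i - z j)).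
  move=> jk; rewrite -(zi _ jk) -valB_neq ?zi //.
  by congr w; ring.
by exists j => k jk; rewrite (zy k jk) (zy j (lexx j)).
Qed.

(** For both limits the value is the minimum of v(z_i - y) and v(z_i - z_j), at an index i where [y]
    fails to be a limit. *)
Lemma val_limits_eq a x y : pseudo_limit w z a -> pseudo_limit w z x ->
  ~ pseudo_limit w z y -> w (x - y) = w (a - y).
Proof.
move=> a_lim x_lim /not_pseudo_limitP[i [j [ij yi]]].
have main b : pseudo_limit w z b -> w (b - y) = Order.min (w (z i - y)) (w (z i - z j)).
  move=> b_lim; rewrite -(b_lim i j ij) (valB vw b) -valB_neq.
    by congr w; ring.
  by rewrite (valB vw (z i) b) (b_lim i j ij).
by rewrite (main x x_lim) (main a a_lim).
Qed.

Lemma val_horner_limits_eq h a x : pseudo_limit w z a -> pseudo_limit w z x ->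
  (forall y, root h y -> ~ pseudo_limit w z y) -> w h.[x] = w h.[a].
Proof.
move=> a_lim x_lim; have [r ->] := closed_field_poly_normal h.
have [->|lh0] := eqVneq (lead_coef h) 0; first by rewrite scale0r !horner0.
move=> h_nl; rewrite !hornerZ; apply: valM_eq => //.
have {h_nl}: forall y, y \in r -> ~ pseudo_limit w z y.
  by move=> y yr; apply: h_nl; rewrite rootZ // root_prod_XsubC.
elim: r => [|c r IH] r_nl; first by rewrite !big_nil !hornerC.
rewrite !big_cons !hornerM !hornerXsubC; apply: valM_eq => //.
  by apply: val_limits_eq => //; apply: r_nl; rewrite mem_head.
by apply: IH => y yr; apply: r_nl; rewrite inE yr orbT.
Qed.

Lemma val_horner_ultimately_constant f : inhabited T ->
  (forall y, root f y -> ~ pseudo_limit w z y) ->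
  exists i0 : T, forall i, (i0 <= i)%O -> w f.[z i] = w f.[z i0].
Proof.
case=> i1; have [r ->] := closed_field_poly_normal f.
have [->|lf0] := eqVneq (lead_coef f) 0.
  by exists i1 => i _; rewrite scale0r !horner0.
move=> f_nl; have {f_nl}: forall y, y \in r -> ~ pseudo_limit w z y.
  by move=> y yr; apply: f_nl; rewrite rootZ // root_prod_XsubC.
move=> r_nl; suff [i0 i0P] : exists i0 : T, forall i, (i0 <= i)%O ->
    w (\prod_(c <- r) ('X - c%:P)).[z i] = w (\prod_(c <- r) ('X - c%:P)).[z i0].
  by exists i0 => i /i0P e; rewrite !hornerZ; apply: valM_eq.
elim: r r_nl => [|c r IH] r_nl; first by exists i1 => i _; rewrite !big_nil !hornerC.
have [|i2 i2P] := IH; first by move=> y yr; apply: r_nl; rewrite inE yr orbT.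
have [|i3 i3P] := @val_ultimately_constant c; first by apply: r_nl; rewrite mem_head.
exists (Order.max i2 i3) => i; rewrite ge_max => /andP[i2i i3i].
rewrite !big_cons !hornerM !hornerXsubC; apply: valM_eq => //.
  by rewrite i3P // [in RHS]i3P // le_max lexx orbT.
by rewrite i2P // [in RHS]i2P // le_max lexx.
Qed.

End PseudoLimits.

(** * Henselizations and Artin-Schreier equations *)

Section Henselization.
Variables (L : closedFieldType) (G : orderedGroupType) (w : L -> value G).
Variables (p : nat) (B : set L).
Hypotheses (vw : valuation w) (pL : p \in [pchar L]).

Lemma henselization_subfield : subfield (henselization w B).
Proof.
split=> [|x y|x y]; rewrite !in_setE.
- by move=> C [[sC _] _]; apply/(subfield_ofP sC)/rpred1.
- move=> xH yH C CH; have [[sC _] _] := CH.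
  by apply/(subfield_ofP sC)/rpredB; apply/subfield_ofP; [apply: xH | apply: yH].
- move=> xH yH C CH; have [[sC _] _] := CH.
  by apply/(subfield_ofP sC)/rpred_div; apply/subfield_ofP; [apply: xH | apply: yH].
Qed.

Lemma henselization_sub : B `<=` henselization w B.
Proof. by move=> x Bx C [_]; apply. Qed.

(** In each henselian field concerned, Hensel's Lemma at 0 gives a root a of X^p - X - e with v(a) >
    0. Then d = a - u satisfies d^p = d and v(d) > 0, which forces d = 0. *)
Lemma henselization_artin_schreier u : w 1 < w u ->
  henselization w B (u ^+ p - u) -> henselization w B u.
Proof.
move=> u_gt uH C CH; have [[sC hC] _] := CH; have p_pr := pcharf_prime pL.
set e := u ^+ p - u in uH *; have e_gt : w 1 < w e.
  by apply: valB_gt => //; rewrite -(expr1n _ p) valX_lt ?prime_gt0.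
have eC : e \in subfield_of sC by apply/subfield_ofP; apply: uH CH.
pose f : {poly L} := 'X^p - 'X - e%:P.
have nat_ge (b : bool) : w 1 <= w b%:R.
  by case: b; rewrite ?val0 ?val1.
have f_ring : f \is a polyOver [in valuation_ring w C].
  apply/allP => _ /(nthP 0)[i _ <-].
  suff f_i : valuation_ring w C f`_i by exact: (mem_set f_i).
  rewrite !coefB coefXn coefX coefC; split.
    apply/(subfield_ofP sC); rewrite !rpredB ?rpred_nat //.
    by case: (i == 0)%N; rewrite ?rpred0.
  rewrite -(val1 vw); apply: valB_ge => //; first by apply: valB_ge.
  by case: (i == 0)%N; rewrite ?val0 ?ltW // val1.
have C0 : valuation_ring w C 0.
  split; last by rewrite val0.
  by apply/(subfield_ofP sC)/rpred0.
have [||a [[Ca _] fa]] := hC f 0 f_ring C0.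
- rewrite !hornerE /= expr0n eqn0Ngt prime_gt0 //= subr0 sub0r valN //.
  by rewrite -(val1 vw).
- rewrite !derivB derivXn derivX derivC subr0 hornerD hornerN hornerC hornerMn.
  by rewrite (mulrn_pchar pL) sub0r valN // val1.
rewrite subr0 -(val1 vw) => a_gt.
suff : a - u == 0 by rewrite subr_eq0 => /eqP <-.
apply: contraT => au0.
have au_gt : w 1 < w (a - u) by apply: valB_gt.
have au_p : (a - u) ^+ p = a - u.
  rewrite -(pFrobenius_autE pL) rmorphB /= !pFrobenius_autE.
  apply/eqP; rewrite -subr_eq0 opprB addrACA [- _ + _]addrC [_ - u ^+ p]addrC.
  move: fa; rewrite rootE !hornerE /= /e opprB => /eqP <-; apply/eqP; ring.
have : w ((a - u) * 1) < w ((a - u) * (a - u) ^+ p.-1).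
  rewrite valM_lt // -(expr1n _ p.-1) valX_lt //.
  by rewrite -ltnS prednK ?prime_gt0 ?prime_gt1.
by rewrite -exprS prednK ?prime_gt0 // au_p mulr1 ltxx.
Qed.

End Henselization.

(* Thus [t] is approximated from [E] with values [w t / p^k]. *)
Lemma iterated_root_approx (L : fieldType) (p : nat) (E : divringClosed L) t :
    p \in [pchar L] ->
    (forall x, x \in E -> exists2 y, y \in E & y ^+ p = x) ->
    t ^+ p - t \in E ->
  forall k, exists2 c, c \in E & (t - c) ^+ (p ^ k) = t.
Proof.
move=> pL E_perfect tE; elim=> [|k [c cE tc]].
  by exists 0; rewrite ?rpred0 // subr0 expr1.
have expB x y : (x - y) ^+ p = x ^+ p - y ^+ p :> L.
  by have := exprB_pchar x y 1 pL; rewrite expn1.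
have [e eE e_p] : exists2 e, e \in E & e ^+ p = (t - c) ^+ p - (t - c).
  apply: E_perfect; rewrite expB.
  have -> : t ^+ p - c ^+ p - (t - c) = (t ^+ p - t) - (c ^+ p - c) by ring.
  by rewrite rpredB // rpredB ?rpredX.
exists (c + e); rewrite ?rpredD // opprD addrA expnS exprM.
by rewrite [X in X ^+ _]expB e_p subKr.
Qed.

(** * Pseudo-convergent sequences over the implicit constant field *)

Theorem proposition8p4
  (G : orderedGroupType) (L : closedFieldType) (w : L -> value G)
  (K F : set L) (p : nat) (X : L)
  (d : Order.disp_t) (T : orderType d) (z : T -> L) :
  valuation w ->
  subfield K ->
  subfield F ->
  algebraic_closure F = setT ->
  p \in [pchar L] ->
  odd p ->
  perfect p K ->
  rank_one w K ->
  function_field_trdeg1 K F ->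
  immediate w K F ->
  K = ramification_field w K ->
  F X ->
  ~ K X ->
  transcendental_over K X ->
  let I := implicit_constant_field w K X in
  limit_ordinal T ->
  (forall i, I (z i)) ->
  pseudo_convergent w z ->
  corresponds w z I X ->
  transcendental_type w z I.
Proof.
move=> vw sK sF F_closure pL _ K_perf K_rank [_ _ _] [KF vFK rFK] K_ram FX _ _ I.
move=> [T_inh _ _] zI z_pc [I_nolim X_lim].
pose A := subfield_of sK; pose B := subfield_of sF.
pose M := henselization w (adjoin K [set X]).
have p_pr := pcharf_prime pL.
have A_conj : ramified_conjugates w A.
  move=> a aA; have [r [ur ar rA r_ram]] := ramification_orbit vw K_ram aA.
  exists r; split=> // c /r_ram[s [_ s_ram] ->] /eqP a0; apply: s_ram => //.
  by case/alg_closureP: aA => q; exists q.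
have A_perf x : x \in A -> exists2 y, y \in A & y ^+ p = x.
  by move=> /subfield_ofP/K_perf[y Ky <-]; exists y => //; apply/subfield_ofP.
have B_alg x : algebraic B x by have : [set: L] x by []; rewrite -F_closure.
have B_val x : x \in B -> exists2 c, c \in A & w c = w x.
  have [->|x0] := eqVneq x 0; first by exists 0; rewrite ?rpred0.
  move=> /subfield_ofP Fx; have [g wx] := val_Some vw x0.
  have [c Kc wc] : value_group w K g by rewrite -vFK; exists x.
  by exists c; rewrite ?wc ?wx //; apply/subfield_ofP.
have B_res x : x \in B -> w 1 <= w x -> exists2 c, c \in A & w 1 < w (x - c).
  move=> /subfield_ofP Fx; rewrite (val1 vw) => x_ge.
  have [c [Kc _] cx] : residue_field w K (residue w x) by rewrite -rFK; exists x.
  exists c; first exact/subfield_ofP.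
  have : residue w x x by rewrite /residue /= subrr val0.
  by rewrite -cx.
have sM : subfield M := henselization_subfield w _.
have sub_M : adjoin K [set X] `<=` M := @henselization_sub _ _ w _.
have KM : K `<=` M by move=> x Kx; apply: sub_M => C [_]; apply; left.
have MX : M X by apply: sub_M => C [_]; apply; right.
have sI : subfield I.
  have I_mem x : (x \in [in I]) = (x \in alg_closure A) && (x \in subfield_of sM).
    apply/idP/andP => [/set_mem[Kx Mx]|[/alg_closureP Kx /subfield_ofP Mx]].
      by split; [apply/alg_closureP|apply/subfield_ofP].
    by apply: mem_set.
  split=> [|x y|x y]; rewrite !I_mem ?rpred1 //.
    by move=> /andP[x1 x2] /andP[y1 y2]; rewrite !rpredB.
  by move=> /andP[x1 x2] /andP[y1 y2]; rewrite !rpred_div.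
pose E := subfield_of sI.
have EA : {subset E <= alg_closure A} by move=> x /subfield_ofP[Kx _]; apply/alg_closureP.
have EM x : x \in E -> x \in subfield_of sM.
  by move=> /subfield_ofP[_ Mx]; apply/subfield_ofP.
have AE : {subset A <= E}.
  move=> x xA; apply/subfield_ofP; split; first by case/alg_closureP: (mem_closure xA) => q; exists q.
  by apply: KM; apply/(subfield_ofP sK).
have E_closure : {subset alg_closure E <= alg_closure A}.
  move=> x /alg_closureP[f [f0 fE fx]]; apply: closure_root f0 fx _.
  by apply/polyOverP => i; apply/EA/(polyOverP fE).
(* A p-th root in [L] is algebraic over [K], so it lies in [E] by separability. *)
have E_perf x : x \in E -> exists2 y, y \in E & y ^+ p = x.
  move=> xE; have [y yx] : exists y, root ('X^p - x%:P) y.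
    by apply/closed_rootP; rewrite size_XnsubC ?prime_gt0 // eqSS -lt0n prime_gt0.
  have y_p : y ^+ p = x by move: yx; rewrite rootE !hornerE subr_eq0 => /eqP.
  exists y => //; apply: (perfect_above pL A_conj AE) => //; last by rewrite y_p.
  apply: (closure_root (monic_neq0 (monicXnsubC x (prime_gt0 p_pr))) yx).
  by rewrite rpredB ?polyOverXn ?polyOverC ?EA.
move=> f0 f0E; apply: contrapT => f0_nc.
pose Q n := `[< exists f a, [/\ f != 0, f \is a polyOver E, root f a,
  pseudo_limit w z a & size f = n] >].
have exQ : exists n, Q n.
  have [a f0a a_lim] : exists2 a, root f0 a & pseudo_limit w z a.
    apply: contrapT => no_a; apply: f0_nc; apply: val_horner_ultimately_constant => //.
    by move=> y f0y y_lim; apply: no_a; exists y.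
  exists (size f0); apply/asboolP; exists f0, a; split=> //.
  by apply: contra_notN f0_nc => /eqP->; case: T_inh => i; exists i => j; rewrite !horner0.
case: (ex_minnP exQ) => n /asboolP[f [a [fn0 fE fa a_lim sz_f]]] n_min.
have aA : a \in alg_closure A by apply/E_closure/alg_closureP; exists f.
have aE : a \notin E by apply/negP => /subfield_ofP /I_nolim; apply.
have [h1 h1E [tE]] := artin_schreier_exists vw pL A_conj AE EA aA aE.
set t := h1.[a] in tE * => t_AS.
(* Reduction modulo [f] keeps the value at [a] and brings the degree below the minimal one. *)
pose h := h1 %% f; have hE : h \is a polyOver E by apply: polyOver_modp.
have t_h : h.[a] = t.
  by rewrite /t [h1](divp_eq h1 f) hornerD hornerM (rootP fa) mulr0 add0r.
(* h - c is nonzero because [t] is not in [E], and its degree is less than deg f; by minimality none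
   of its roots is a limit. *)
have wX c : c \in E -> w (h.[X] - c) = w (t - c).
  move=> cE; have := @val_horner_limits_eq _ _ w _ _ z vw (h - c%:P) a X a_lim X_lim.
  rewrite !hornerD !hornerN !hornerC t_h; apply=> y hy y_lim.
  have hc0 : h - c%:P != 0.
    apply: contraNneq tE => /subr0_eq h_c.
    by rewrite -t_h h_c hornerC.
  have : (n <= size (h - c%:P)%R)%N.
    apply: n_min; apply/asboolP; exists (h - c%:P), y; split=> //.
    by rewrite rpredB ?polyOverC.
  rewrite leqNgt -sz_f => /negP; apply.
  apply: leq_ltn_trans (size_polyD _ _) _; rewrite gtn_max size_polyN ltn_modp fn0.
  by apply: leq_ltn_trans (size_polyC_leq1 _) _; apply: root_size_gt1 fn0 fa.
have t0 : t != 0 by apply: contraNneq tE => ->; apply: rpred0.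
pose u := h.[X] - t.
(* u = (h(X) - c) - (t - c) is a difference of two elements of the same value, and c can be chosen
   with (t - c)^(p^k) = t. *)
have u_ge : w 1 <= w u.
  apply: (val_ge1_of_powers vw pL B_val B_alg _ t0) => [x y xA yA|k].
    by apply: (rank_one_archimedean vw sK K_rank); apply/mem_set/(subfield_ofP sK).
  have [c cE {1}<-] := iterated_root_approx pL E_perf t_AS k.
  apply: valX_le => //; have -> : u = (h.[X] - c) - (t - c) by rewrite /u; ring.
  by apply: valB_ge => //; rewrite ?wX.
have [c cA uc] := residue_exists vw pL B_alg A_conj A_perf B_res u_ge.
have ME x : x \in E -> x \in subfield_of sM by apply: EM.
have hXM : h.[X] \in subfield_of sM.
  apply: rpred_horner; last exact/subfield_ofP.
  by apply/polyOverP => i; apply/ME/(polyOverP hE).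
have cM : c \in subfield_of sM by apply/ME/AE.
(* By additivity of the Frobenius map, (u - c)^p - (u - c) involves [t] only through t^p - t, which
   is in [E]. *)
have ucM : M (u - c).
  apply: (henselization_artin_schreier vw pL uc); apply/(subfield_ofP sM).
  have expB x y : (x - y) ^+ p = x ^+ p - y ^+ p :> L.
    by have := exprB_pchar x y 1 pL; rewrite expn1.
  have -> : (u - c) ^+ p - (u - c) =
      (h.[X] ^+ p - h.[X]) - (c ^+ p - c) - (t ^+ p - t).
    by rewrite /u !expB; ring.
  apply: rpredB (ME _ t_AS); by apply: rpredB; apply: rpredB => //; apply: rpredX.
have tA : t \in alg_closure A.
  by apply/E_closure/closure_horner => //; apply/alg_closureP; exists f.
case/negP: tE; apply/subfield_ofP; split; first by case/alg_closureP: tA => q; exists q.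
apply/(subfield_ofP sM); have -> : t = h.[X] - c - (u - c) by rewrite /u; ring.
by apply: rpredB; [apply: rpredB|apply/subfield_ofP].
Qed.
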